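(* The class of $AC(\sigma)$ operators is a proper subset of the class of $AC$ operators of Berkson and Gillespie. That is: every $AC(\sigma)$ operator (for some nonempty compact $\sigma\subset\mathbb{C}$) on a complex Banach space is an $AC$ operator, and there exist a complex Banach space $X$ and an $AC$ operator $T\in B(X)$ such that $T$ is not an $AC(\sigma)$ operator for any nonempty compact $\sigma\subset\mathbb{C}$.
   Context: Let $\sigma\subset\mathbb{C}\cong\mathbb{R}^2$ be nonempty and compact. Let $\Gamma=C([0,1],\mathbb{C})$ be the set of curves. For $\gamma\in\Gamma$ and $f:\sigma\to\mathbb{C}$ put $\operatorname{cvar}(f,\gamma)=\sup\sum_{i=1}^{n-1}|f(s_{i+1})-f(s_i)|$, the supremum over finite sequences $s_i=\gamma(t_i)\in\sigma$ with $0\le t_1\le\dots\le t_n\le 1$. For a line $l$, $\operatorname{vf}(\gamma,l)$ is the number of times $\gamma$ crosses $l$, i.e. the number of entry points: $t\in[0,1]$ with $\gamma(t)\in l$ and either $t=0$ or for every $\epsilon>0$ there is $s\in(t-\epsilon,t)\cap[0,1]$ with $\gamma(s)\notin l$. Put $\operatorname{vf}(\gamma)=\sup_l\operatorname{vf}(\gamma,l)$, $\rho(\gamma)=1/\operatorname{vf}(\gamma)$ (with $\rho(\gamma)=0$ if $\operatorname{vf}(\gamma)=\infty$), $\operatorname{var}(f,\sigma)=\sup_{\gamma\in\Gamma}\rho(\gamma)\operatorname{cvar}(f,\gamma)$, and $\|f\|_{BV(\sigma)}=\|f\|_\infty+\operatorname{var}(f,\sigma)$. $BV(\sigma)$ is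 the Banach algebra of all $f:\sigma\to\mathbb{C}$ with $\|f\|_{BV(\sigma)}<\infty$, and $AC(\sigma)$ is the closed subalgebra of $BV(\sigma)$ generated by $1$, $\boldsymbol{\lambda}$ and $\overline{\boldsymbol{\lambda}}$, where $\boldsymbol{\lambda}(z)=z$, with the $BV(\sigma)$ norm. For $\sigma=[a,b]$ these are the usual spaces of functions of bounded variation and absolutely continuous functions. For a complex Banach space $X$, $T\in B(X)$ is an $AC(\sigma)$ operator if there is a bounded unital algebra homomorphism $\psi:AC(\sigma)\to B(X)$ with $\psi(\boldsymbol{\lambda})=T$. $T$ is called an $AC(\sigma)$ operator, with $\sigma$ unspecified, if this holds for some nonempty compact $\sigma$. $T$ is well-bounded if it is an $AC(J)$ operator for some compact interval $J\subset\mathbb{R}$. $AC$ operators (Berkson-Gillespie) are operators with a functional calculus for the absolutely continuous functions, in the sense of Hardy and Krause, on a rectangle $J\times K$. By a theorem of Berkson and Gillespie, $T\in B(X)$ is an $AC$ operator if and only if $T=R+iS$ with $R,S\in B(X)$ commuting well-bounded operators; this characterization may be taken as the definition. *)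

(* Defs.v *)
From HB Require Import structures.
From mathcomp Require Import all_boot all_order all_algebra.
From mathcomp Require Import complex.
From mathcomp Require Import all_classical all_reals all_analysis.

Set Implicit Arguments.
Unset Strict Implicit.
Unset Printing Implicit Defensive.

Import Order.TTheory GRing.Theory Num.Theory.
Import numFieldNormedType.Exports.

Local Open Scope classical_set_scope.
Local Open Scope ring_scope.
Local Open Scope complex_scope.

(* [R[i]] carries no topology in the libraries; it receives the one that every
   numFieldType has through its regular algebra, given by the modulus. *)
HB.instance Definition _ (R : realType) := PseudoPointedMetric.copy R[i] R[i]^o.
HB.instance Definition _ (R : realType) := NormedModule.copy R[i] R[i]^o.

Section Variation.
Variable R : realType.
Local Notation C := R[i].

Definition modulus (z : C) : R := ComplexField.Normc.normc z.

(* Only the values of a curve on [0, 1] are ever used. *)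
Definition curve (gamma : R -> C) : Prop := {within `[0, 1], continuous gamma}.

Definition line (l : set C) : Prop :=
  exists a b c : R, (a != 0 \/ b != 0) /\
    l = [set z | a * complex.Re z + b * complex.Im z = c].

Definition entry_points (gamma : R -> C) (l : set C) : set R :=
  [set t | [/\ t \in `[0, 1], l (gamma t) &
    t = 0 \/ forall e : R, 0 < e ->
      exists s : R, [/\ s \in `]t - e, t[, s \in `[0, 1] & ~ l (gamma s)]]].

Definition vf_line (gamma : R -> C) (l : set C) : \bar R :=
  counting (entry_points gamma l).

Definition vf (gamma : R -> C) : \bar R :=
  ereal_sup [set vf_line gamma l | l in line].

(* The inverse of [+oo] is [0]; [vf gamma] is at least 1, because [t = 0] is an
   entry point for any line through [gamma 0]. *)
Definition rho (gamma : R -> C) : \bar R := ((vf gamma)^-1)%E.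

Variable sigma : set C.

(* The sample points are [s 0, ..., s n.-1]. The empty sample [n = 0] is allowed,
   so that a curve missing [sigma] has [cvar] equal to 0. *)
Definition cvar (f : sigma -> C) (gamma : R -> C) : \bar R :=
  ereal_sup [set v | exists (n : nat) (t : nat -> R) (s : nat -> sigma),
    [/\ forall i, (i < n)%N -> t i \in `[0, 1],
        forall i, (i.+1 < n)%N -> t i <= t i.+1,
        forall i, (i < n)%N -> set_val (s i) = gamma (t i) &
        v = (\sum_(i < n.-1) modulus (f (s i.+1) - f (s i)))%:E]].

(* Here [0 * +oo = 0]: curves with infinite [vf] do not contribute. *)
Definition var (f : sigma -> C) : \bar R :=
  ereal_sup [set (rho gamma * cvar f gamma)%E | gamma in curve].

Definition sup_norm (f : sigma -> C) : \bar R :=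
  ereal_sup [set (modulus (f z))%:E | z in [set: sigma]].

Definition BV_norm (f : sigma -> C) : \bar R := (sup_norm f + var f)%E.

Definition BV_space : set (sigma -> C) := [set f | (BV_norm f < +oo)%E].

Definition closed_subalgebra (A : set (sigma -> C)) : Prop :=
  [/\ A `<=` BV_space,
      A 1,
      (forall f g, A f -> A g -> A (f + g)) /\
      (forall f g, A f -> A g -> A (f * g)),
      forall (c : C) f, A f -> A (c *: f) &
      forall f, BV_space f ->
        (forall e : R, 0 < e -> exists2 g, A g & (BV_norm (f - g)%R < e%:E)%E) ->
        A f].

Definition lambda : sigma -> C := fun z => set_val z.
Definition lambda_bar : sigma -> C := fun z => (set_val z)^*.

Definition AC_space : set (sigma -> C) :=
  smallest closed_subalgebra [set f | [\/ f = 1, f = lambda | f = lambda_bar]].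

End Variation.

Section Operators.
Variables (R : realType) (X : completeNormedModType R[i]).
Local Notation C := R[i].

(* [B(X)] consists of the [T : {linear X -> X}] that are continuous. *)

(* [psi] is constrained only on [AC_space sigma]. *)
Definition bounded_unital_hom (sigma : set C)
    (psi : (sigma -> C) -> {linear X -> X}) : Prop :=
  [/\ forall f, AC_space f -> continuous (psi f),
      forall x, psi 1 x = x,
      (forall f g, AC_space f -> AC_space g -> forall x, psi (f + g) x = psi f x + psi g x) /\
      (forall f g, AC_space f -> AC_space g -> forall x, psi (f * g) x = psi f (psi g x)),
      forall (c : C) f, AC_space f -> forall x, psi (c *: f) x = c *: psi f x &
      exists M : R, forall f, AC_space f -> forall x,
        `|psi f x| <= (M * fine (BV_norm f))%:C * `|x|].

Definition AC_sigma_operator (sigma : set C) (T : {linear X -> X}) : Prop :=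
  continuous T /\
  exists psi : (sigma -> C) -> {linear X -> X},
    bounded_unital_hom psi /\ forall x, psi (@lambda R sigma) x = T x.

Definition well_bounded (T : {linear X -> X}) : Prop :=
  exists a b : R, a <= b /\ AC_sigma_operator [set x%:C | x in `[a, b]] T.

(* The operators of Berkson and Gillespie, in their form [A + iB]. *)
Definition AC_operator (T : {linear X -> X}) : Prop :=
  exists A B : {linear X -> X},
    [/\ well_bounded A, well_bounded B,
        forall x, A (B x) = B (A x) &
        forall x, T x = A x + 'i *: B x].

End Operators.

(* Main.v *)
Require Import Defs.
From HB Require Import structures.
From mathcomp Require Import all_boot all_order all_algebra.
From mathcomp Require Import complex finmap.
From mathcomp Require Import all_classical all_reals all_analysis measurable_realfun.
From mathcomp Require Import ring lra zify.

(** Let T be an operator with an AC(sigma) calculus psi. Composing a function f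
    on a segment [a, b] with a real linear form l that maps sigma into [a, b]
    does not increase the BV norm: a curve gamma projects to the curve
    l o gamma, and wherever l o gamma enters a line transversal to the real
    axis, gamma enters a level line of l. Hence f o l lies in AC(sigma) whenever
    f lies in AC[a, b] ([AC_proj]), and f |-> psi (f o l) is an AC[a, b]
    calculus for psi l ([hom_proj]). With l = Re and l = Im this writes T as
    A + iB with A and B well bounded and commuting, which is the inclusion. But
    l = Re - Im is allowed too, so A - B is also well bounded
    ([AC_sigma_real_parts]). The strictness of the inclusion comes from an
    operator A + iB for which this last property fails.

    The complex sequences of bounded variation form a Banach space on which
    they act by multiplication. If a real sequence a is monotone with values in
    [0, 1], then f o a has bounded variation for each f in BV[0, 1], because the
    a_n can be used as parameters of the straight path; so multiplication by a
    is well bounded ([well_bounded_coeff]). Take two such sequences a and b that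
    increase in turn, along a staircase: then a_n - b_n is 0 for even n and
    2^-(j+1) for n = 2j + 1. Multiplication by a - b is not well bounded. Indeed
    the polynomials (1 - (x/L)^2)^k have BV norm at most 3 on a given segment,
    uniformly in k ([bump_bv]), but for large k their values along a - b
    alternate between 1 and nearly 0 as long as one likes
    ([zigzag_difference_not_well_bounded]).

    It remains to see that a hypothetical calculus for the zigzag operator
    T = a + ib produces this very splitting. The real parts A and B that it
    yields commute with T, whose eigenvalues are distinct on the unit vectors,
    so A and B have the unit vectors as eigenvectors, and eigenvalues u_n, v_n
    with u_n + i v_n = a_n + i b_n. The eigenvalues of a well-bounded operator
    are real ([well_bounded_eigen_real]): at a point p + iv with v nonzero the
    polynomials (1 - ((x - p)/L)^2)^k take the values (1 + (v/L)^2)^k, which are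
    unbounded in k, while their norms are at most 3. Hence u_n = a_n and
    v_n = b_n.

    Both uses of the bumps, and the finiteness of the variation of the
    coordinate function, rest on a bound in the manner of the Banach indicatrix
    ([banach_indicatrix]): if a function on a segment takes each value at most
    twice, its jumps along a curve cover each level at most 2 vf(gamma) times. *)

Set Implicit Arguments.
Unset Strict Implicit.
Unset Printing Implicit Defensive.

Import Order.TTheory GRing.Theory Num.Theory.
Import numFieldNormedType.Exports.

Local Open Scope classical_set_scope.
Local Open Scope ring_scope.
Local Open Scope complex_scope.

(** * The modulus, and crossings of vertical lines by a curve *)

Section Modulus.
Variable R : realType.
Local Notation C := R[i].

Lemma normE (z : C) : `|z| = (modulus z)%:C.
Proof. by case: z => a b; rewrite normc_def. Qed.

Lemma modulus_ge0 (z : C) : 0 <= modulus z.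
Proof. by rewrite -lecR -normE normr_ge0. Qed.

Lemma modulusD (x y : C) : modulus (x + y) <= modulus x + modulus y.
Proof. by rewrite -lecR rmorphD /= -!normE ler_normD. Qed.

Lemma modulusM (x y : C) : modulus (x * y) = modulus x * modulus y.
Proof. exact: ComplexField.Normc.normcM. Qed.

Lemma modulusN (x : C) : modulus (- x) = modulus x.
Proof. by apply: complexI; rewrite -!normE normrN. Qed.

Lemma modulusB (x y : C) : modulus (x - y) = modulus (y - x).
Proof. by rewrite -modulusN opprB. Qed.

Lemma modulus0 : modulus (0 : C) = 0.
Proof. by apply: complexI; rewrite -normE normr0. Qed.

Lemma modulus1 : modulus (1 : C) = 1.
Proof. by apply: complexI; rewrite -normE normr1. Qed.

Lemma modulus_eq0 (x : C) : modulus x = 0 -> x = 0.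
Proof. by move=> h; apply/eqP; rewrite -normr_eq0 normE h. Qed.

Lemma modulusR (x : R) : modulus x%:C = `|x|.
Proof. by rewrite /modulus /= expr0n addr0 sqrtr_sqr. Qed.

Lemma Re_le_modulus (z : C) : `|complex.Re z| <= modulus z.
Proof.
by case: z => a b /=; rewrite -sqrtr_sqr ler_wsqrtr// lerDl sqr_ge0.
Qed.

Lemma Im_le_modulus (z : C) : `|complex.Im z| <= modulus z.
Proof.
by case: z => a b /=; rewrite -sqrtr_sqr ler_wsqrtr// lerDr sqr_ge0.
Qed.

Lemma modulus_le_ReIm (z : C) :
  modulus z <= `|complex.Re z| + `|complex.Im z|.
Proof.
rewrite [z in modulus z]complexE (le_trans (modulusD _ _))//.
by rewrite modulusM !modulusR /modulus/= expr0n expr1n add0r sqrtr1 mul1r.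
Qed.

End Modulus.


Section Counting.
Variable R : realType.

Lemma counting_ge_seq (T : choiceType) (A : set T) (s : seq T) :
  uniq s -> (forall x, x \in s -> A x) ->
  (((size s)%:R : R)%:E <= counting A)%E.
Proof.
move=> us sA; rewrite /counting; case: ifPn => [/asboolP fA|_]; last first.
  by rewrite leey.
rewrite lee_fin ler_nat -(undup_id us) -card_fseq fsubset_leq_card//.
apply/fsubsetP => x; rewrite inE /= => xs.
by rewrite in_fset_set// inE; exact: sA.
Qed.

Lemma counting_le (T : choiceType) (A B : set T) :
  A `<=` B -> (counting A <= counting B :> \bar R)%E.
Proof.
move=> AB; rewrite /counting; case: (asboolP (finite_set B)) => fB; last first.
  by rewrite leey.
have fA := sub_finite_set AB fB.
by rewrite asboolT// lee_fin ler_nat fsubset_leq_card// -fset_set_sub.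
Qed.

Lemma counting_le1 (T : choiceType) (A : set T) x :
  A `<=` [set x] -> (counting A <= 1%:E :> \bar R)%E.
Proof.
move=> /counting_le /le_trans; apply.
by rewrite /counting asboolT//= fset_set1 cardfs1.
Qed.

End Counting.

Section Curves.
Variable R : realType.
Local Notation C := R[i].

Lemma curveP (gamma : R -> C) : curve gamma <->
  forall t, t \in `[0, 1] -> forall e : R, 0 < e ->
    exists2 d : R, 0 < d & forall s, s \in `[0, 1] -> `|t - s| < d ->
      modulus (gamma t - gamma s) < e.
Proof.
rewrite /curve subspace_continuousP; split => [h t t01 e e0|h t t01].
  have /cvgrPdist_lt /(_ e%:C) : gamma @ within `[0, 1] (nbhs t) --> gamma t.
    exact: h.
  rewrite ltcR => /(_ e0)/nbhs_ballP [d /= d0 hd]; exists d => // s s01 ts.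
  by have := hd s ts s01; rewrite /= normE ltcR.
apply/cvgrPdist_lt => e; rewrite ltcE => /= /andP[/eqP ime e0].
have [d d0 hd] := h t t01 _ e0.
apply/nbhs_ballP; exists d => //= s ts s01.
have := hd s s01 ts; rewrite -ltcR -normE; congr (_ < _).
by apply/eqP; rewrite eq_complex /= ime !eqxx.
Qed.

Lemma vertical_line (p : R) : line [set z : C | complex.Re z = p].
Proof.
exists 1, 0, p; split; first by left; rewrite oner_eq0.
by apply/seteqP; split => z /=; rewrite mul1r mul0r addr0.
Qed.

Lemma vf_line_le (gamma : R -> C) l : line l -> (vf_line gamma l <= vf gamma)%E.
Proof. by move=> ll; apply: ereal_sup_ubound; exists l. Qed.

(** The start of a curve is an entry point for the vertical line through
    it. *)
Lemma vf_ge1 (gamma : R -> C) : (1%:E <= vf gamma)%E.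
Proof.
apply: le_trans (vf_line_le gamma (vertical_line (complex.Re (gamma 0)))).
apply: (@counting_ge_seq _ _ _ [:: 0 : R]) => // t; rewrite inE => /eqP ->.
by split => //; [rewrite in_itv /= lexx ler01|left].
Qed.

(** The real part takes the value p between t1 and t2 by the intermediate
    value theorem, and the first time at which it does so is an entry
    point. *)
Lemma vf_line_entry (gamma : R -> C) (p t1 t2 : R) : curve gamma ->
  t1 \in `[0, 1] -> t2 \in `[0, 1] -> t1 <= t2 ->
  Num.min (complex.Re (gamma t1)) (complex.Re (gamma t2)) < p <
  Num.max (complex.Re (gamma t1)) (complex.Re (gamma t2)) ->
  exists2 t, t1 < t < t2 & entry_points gamma [set z | complex.Re z = p] t.
Proof.
move=> /curveP gc t1i t2i t12 pi.
set h := fun t => complex.Re (gamma t).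
have hc t : t \in `[0, 1] -> forall e : R, 0 < e ->
    exists2 d : R, 0 < d & forall s, s \in `[0, 1] -> `|t - s| < d ->
      `|h t - h s| < e.
  move=> t01 e e0; have [d d0 hd] := gc t t01 e e0; exists d => // s s01 ts.
  apply: le_lt_trans (hd s s01 ts).
  by rewrite (le_trans _ (Re_le_modulus _))//= raddfB.
have sub t : t \in `[t1, t2] -> t \in `[0, 1].
  move: t1i t2i; rewrite !in_itv /= => /andP[a b] /andP[c d] /andP[e f].
  by rewrite (le_trans a)//= (le_trans f).
have hcont : {within `[t1, t2], continuous h}.
  apply/subspace_continuousP => t ti; apply/cvgrPdist_lt => e e0.
  have [d d0 hd] := hc t (sub _ ti) e e0.
  by apply/nbhs_ballP; exists d => //= s ts si; apply: hd => //; exact: sub.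
have ht12 : h t1 != p /\ h t2 != p.
  move/andP: pi; rewrite -/(h t1) -/(h t2).
  have [lt|lt] := leP (h t1) (h t2) => -[p1 p2].
    by rewrite !neq_lt p1 p2 orbT.
  by rewrite !neq_lt p1 p2 orbT.
have [c ci hcp] : exists2 c, c \in `[t1, t2] & h c = p.
  by apply: IVT => //; case/andP: pi => p1 p2; rewrite !ltW.
pose S := [set t | t \in `[t1, t2] /\ h t = p].
have S0 : S !=set0 by exists c.
have lS : has_lbound S by exists t1 => t [] /itvP ->.
have iS : has_inf S by [].
(* The first time after t1 at which the curve is on the line; every earlier
   time after t1 is off the line. *)
set t := inf S.
have tle s : S s -> t <= s by move=> Ss; exact: ge_inf.
have tge1 : t1 <= t by apply: lb_le_inf => // s [] /itvP ->.
have tle2 : t <= t2 by rewrite (le_trans (tle c _))//; move/itvP: ci => ->.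
have ti : t \in `[t1, t2] by rewrite in_itv /= tge1.
have htp : h t = p.
  apply: contrapT => /eqP htp.
  have [|d d0 hd] := hc t (sub _ ti) `|h t - p|.
    by rewrite normr_gt0 subr_eq0.
  have [s Ss std] := inf_adherent d0 iS.
  have : `|h t - h s| < `|h t - p|.
    apply: hd; first by case: Ss => /sub.
    by rewrite ler0_norm ?subr_le0 ?tle// opprB ltrBlDl.
  by case: Ss => _ ->; rewrite ltxx.
have t1t : t1 < t.
  rewrite lt_neqAle tge1 andbT; apply/eqP => e; move: ht12 => [/eqP + _].
  by rewrite e.
have tt2 : t < t2.
  rewrite lt_neqAle tle2 andbT; apply/eqP => e; move: ht12 => [_ /eqP].
  by rewrite -e.
exists t; first by rewrite t1t.
split => //; first exact: sub.
right => e e0; exists (Num.max t1 (t - e / 2)).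
have e20 : 0 < e / 2 by rewrite divr_gt0.
have si : Num.max t1 (t - e / 2) \in `[t1, t2].
  by rewrite in_itv /= le_max lexx /= ge_max; apply/andP; split; lra.
have st : Num.max t1 (t - e / 2) < t.
  by rewrite gt_max t1t /=; lra.
split.
- by rewrite in_itv /= st andbT lt_max; apply/orP; right; lra.
- exact: sub.
- by move=> hsp; move: st; rewrite ltNge tle.
Qed.

End Curves.

(** * Functions of bounded variation on a plane set *)

Section Variation.
Variables (R : realType) (sigma : set R[i]).
Local Notation C := R[i].
Implicit Types (f g : sigma -> C) (F G K L : R).

(** The samples that compete in the supremum defining cvar. *)
Definition sampled (gamma : R -> C) (n : nat) (t : nat -> R) (s : nat -> sigma) :=
  [/\ forall i, (i < n)%N -> t i \in `[0, 1],
      forall i, (i.+1 < n)%N -> t i <= t i.+1 &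
      forall i, (i < n)%N -> set_val (s i) = gamma (t i)].

Definition jumps f (n : nat) (s : nat -> sigma) : R :=
  \sum_(i < n.-1) modulus (f (s i.+1) - f (s i)).

(** The bound var f <= K with the weight rho cleared, so that variation can
    be estimated in the reals; var_leP is the equivalence. *)
Definition var_le f K := forall (gamma : R -> C) (V : R),
  curve gamma -> (vf gamma <= V%:E)%E ->
  forall n t s, sampled gamma n t s -> jumps f n s <= K * V.

Lemma rho_ge0 (gamma : R -> C) : (0 <= rho gamma)%E.
Proof. by rewrite inve_ge0 (le_trans _ (vf_ge1 gamma))// lee_fin ler01. Qed.

Lemma var_leP f K : 0 <= K -> (var f <= K%:E)%E <-> var_le f K.
Proof.
move=> K0; split => [fK gamma V gc gV n t s [s1 s2 s3]|fK].
  have := vf_ge1 gamma.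
  case vE : (vf gamma) gV => [v| |] //; rewrite !lee_fin => vV v1.
  have v0 : 0 < v by rewrite (lt_le_trans ltr01).
  have : (rho gamma * cvar f gamma <= K%:E)%E.
    by apply: le_trans fK; apply: ereal_sup_ubound; exists gamma.
  rewrite /rho vE inver gt_eqF// lee_pdivrMl// => h.
  have : ((jumps f n s)%:E <= v%:E * K%:E)%E.
    by apply: le_trans h; apply: ereal_sup_ubound; exists n, t, s.
  rewrite -EFinM lee_fin mulrC => /le_trans; apply; exact: ler_wpM2l.
apply: ge_ereal_sup => _ [gamma gc <-].
have := vf_ge1 gamma.
rewrite /rho; case vE : (vf gamma) => [v| |] //; last first.
  by rewrite invey mul0e lee_fin.
rewrite lee_fin => v1.
have v0 : 0 < v by rewrite (lt_le_trans ltr01).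
rewrite inver gt_eqF// lee_pdivrMl//.
apply: ge_ereal_sup => _ [n [t [s [s1 s2 s3 ->]]]].
rewrite -EFinM lee_fin mulrC; apply: (fK gamma v _ _ _ t) => //.
by rewrite vE.
Qed.

(** A bound F for the sup norm and a bound K for the variation. Keeping the
    two apart is what the Leibniz rule needs. *)
Definition bv_le f F K :=
  [/\ 0 <= F, 0 <= K, forall z, modulus (f z) <= F & var_le f K].

Lemma bv_le_norm f F K : bv_le f F K -> (BV_norm f <= (F + K)%:E)%E.
Proof.
move=> [F0 K0 fF /(var_leP _ K0) fK]; rewrite EFinD leeD//.
by apply: ge_ereal_sup => _ [z _ <-]; rewrite lee_fin.
Qed.

Lemma bv_le_BV f F K : bv_le f F K -> BV_space f.
Proof. by move=> /bv_le_norm /le_lt_trans; apply; rewrite ltry. Qed.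

Lemma sup_norm_ge0 f : sigma !=set0 -> (0 <= sup_norm f)%E.
Proof.
move=> [z sz]; pose z' : sigma := SigSub (mem_set sz).
apply: (@le_trans _ _ (modulus (f z'))%:E); first by rewrite lee_fin modulus_ge0.
by apply: ereal_sup_ubound; exists z'.
Qed.

Lemma var_ge0 f : sigma !=set0 -> (0 <= var f)%E.
Proof.
move=> [z sz]; pose z' : sigma := SigSub (mem_set sz).
apply: (@le_trans _ _ (rho (fun=> z) * cvar f (fun=> z))%E).
  apply: mule_ge0; first exact: rho_ge0.
  apply: ereal_sup_ubound; exists 0%N, (fun=> 0), (fun=> z').
  by split => //; rewrite big_ord0.
apply: ereal_sup_ubound; exists (fun=> z) => //.
by apply: continuous_subspaceT => x; exact: cvg_cst.
Qed.

Lemma BV_bv_le f : sigma !=set0 -> BV_space f ->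
  exists F K, bv_le f F K /\ fine (BV_norm f) = F + K.
Proof.
move=> s0; rewrite /BV_space /= /BV_norm.
have := sup_norm_ge0 f s0; have := var_ge0 f s0.
case vE : (var f) => [K| |] //; case sE : (sup_norm f) => [F| |] //.
rewrite !lee_fin => K0 F0 _; exists F, K; split => //; split => //.
  move=> z; rewrite -lee_fin -sE; apply: ereal_sup_ubound; by exists z.
by apply/var_leP => //; rewrite vE.
Qed.

Lemma bv_le_fine f F K : sigma !=set0 -> bv_le f F K ->
  fine (BV_norm f) <= F + K.
Proof.
move=> s0 fFK; have := bv_le_norm fFK.
have := sup_norm_ge0 f s0; have := var_ge0 f s0.
by rewrite /BV_norm; case: (var f) (sup_norm f) => [x| |] [y| |].
Qed.

Lemma bv_le1 : bv_le 1 1 0.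
Proof.
split => // [z|gamma V gc gV n t s _].
  by rewrite [X in modulus X](_ : _ = 1)// modulus1.
rewrite mul0r /jumps big1 // => i _.
rewrite [X in modulus X](_ : _ = 0) ?modulus0//; exact: subrr.
Qed.

Lemma bv_leD f g F G K L :
  bv_le f F K -> bv_le g G L -> bv_le (f + g) (F + G) (K + L).
Proof.
move=> [F0 K0 fF fK] [G0 L0 gG gL]; split; rewrite ?addr_ge0//.
  by move=> z; rewrite (le_trans (modulusD _ _))// lerD.
move=> gamma V gc gV n t s st; rewrite mulrDl.
apply: le_trans (lerD (fK _ _ gc gV _ _ _ st) (gL _ _ gc gV _ _ _ st)).
rewrite -big_split /=; apply: ler_sum => i _.
rewrite (_ : _ - _ = f (s i.+1) - f (s i) + (g (s i.+1) - g (s i))) ?modulusD//.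
by rewrite addrACA -opprD.
Qed.

Lemma bv_leZ (c : C) f F K :
  bv_le f F K -> bv_le (c *: f) (modulus c * F) (modulus c * K).
Proof.
move=> [F0 K0 fF fK]; have c0 := modulus_ge0 c; split; rewrite ?mulr_ge0//.
  by move=> z; rewrite modulusM ler_wpM2l.
move=> gamma V gc gV n t s st; rewrite -mulrA.
apply: le_trans (ler_wpM2l c0 (fK _ _ gc gV _ _ _ st)).
rewrite mulr_sumr; apply: ler_sum => i _.
by rewrite -modulusM mulrBr.
Qed.

Lemma bv_leM f g F G K L :
  bv_le f F K -> bv_le g G L -> bv_le (f * g) (F * G) (F * L + G * K).
Proof.
move=> [F0 K0 fF fK] [G0 L0 gG gL]; split; rewrite ?addr_ge0 ?mulr_ge0//.
  by move=> z; rewrite modulusM ler_pM// modulus_ge0.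
move=> gamma V gc gV n t s st; rewrite mulrDl -!mulrA.
apply: le_trans (lerD (ler_wpM2l F0 (gL _ _ gc gV _ _ _ st))
  (ler_wpM2l G0 (fK _ _ gc gV _ _ _ st))).
rewrite !mulr_sumr -big_split /=; apply: ler_sum => i _.
set a := s i.+1; set b := s i.
have -> : (f * g) a - (f * g) b = f a * (g a - g b) + g b * (f a - f b).
  have -> : (f * g) a - (f * g) b = f a * g a - f b * g b by [].
  by ring.
rewrite (le_trans (modulusD _ _))// !modulusM.
by rewrite lerD// ler_wpM2r// modulus_ge0.
Qed.

(** By the Leibniz rule BV is itself one of the closed subalgebras over
    which AC is an intersection, once it contains the generators; in
    particular AC lies in BV. *)
Lemma BV_closed_subalgebra : sigma !=set0 -> closed_subalgebra (@BV_space R sigma).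
Proof.
move=> s0; split => //.
- exact: bv_le_BV bv_le1.
- split=> f g /(BV_bv_le s0) [F [K [fFK _]]] /(BV_bv_le s0) [G [L [gGL _]]].
    exact: bv_le_BV (bv_leD fFK gGL).
  exact: bv_le_BV (bv_leM fFK gGL).
- move=> c f /(BV_bv_le s0) [F [K [fFK _]]].
  exact: bv_le_BV (bv_leZ c fFK).
Qed.

Lemma AC_closed_subalgebra :
  sigma !=set0 -> BV_space (@lambda R sigma) -> BV_space (@lambda_bar R sigma) ->
  closed_subalgebra (@AC_space R sigma).
Proof.
move=> s0 bl blb; split.
- move=> f; apply; split; first exact: BV_closed_subalgebra.
  by move=> _ [->|->|->] //; exact: bv_le_BV bv_le1.
- by move=> A [[]].
- split=> f g fA gA A Aa; case: (Aa) => -[_ _ [hD hM] _ _] _;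
    [apply: hD|apply: hM]; [exact: fA|exact: gA|exact: fA|exact: gA].
- by move=> c f fA A Aa; case: (Aa) => -[_ _ _ hZ _] _; apply: hZ; exact: fA.
- move=> f fB fa A Aa; case: (Aa) => -[_ _ _ _ hc] _; apply: hc => // e e0.
  by have [g gA fg] := fa e e0; exists g => //; exact: gA.
Qed.

End Variation.

(** * Variation on a segment: the indicatrix bound and the bump functions *)

Section Indicatrix.
Variable R : realType.
Local Notation C := R[i].

(** Integrate the number of intervals covering y over y in [c, d]. *)
Lemma sum_lengths_le (n : nat) (lo hi : nat -> R) (c d K : R) : c <= d ->
  (forall i, (i < n)%N -> [/\ c <= lo i, lo i <= hi i & hi i <= d]) ->
  (forall y, \sum_(i < n) (lo i < y < hi i)%R%:R <= K) ->
  \sum_(i < n) (hi i - lo i) <= K * (d - c).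
Proof.
move=> cd lohi sK.
have K0 : 0 <= K by apply: le_trans (sK 0); apply: sumr_ge0.
pose mu := @lebesgue_measure R.
pose D : set (measurableTypeR R) := [set` `[c, d]].
have mD : measurable D by exact: measurable_itv.
pose h (i : nat) (x : measurableTypeR R) : \bar R :=
  (\1_([set` `]lo i, hi i[] : set (measurableTypeR R)) x)%:E.
have mh i : measurable_fun D (h i).
  by apply/measurable_EFinP; exact: measurable_indic.
have h0 i x : (0 <= h i x)%E by rewrite lee_fin.
have eqK : (\int[mu]_(x in D) (cst K%:E) x = (K * (d - c))%:E)%E.
  rewrite integral_cst//= /mu /D lebesgue_measure_itv /= lte_fin.
  move: cd; rewrite le_eqVlt => /orP[/eqP ->|->//].
  by rewrite ltxx subrr mulr0 mule0.
have eqS : (\int[mu]_(x in D) (\sum_(i < n) h i x) =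
    (\sum_(i < n) (hi i - lo i))%:E)%E.
  rewrite ge0_integral_sum// -sumEFin; apply: eq_bigr => i _.
  have [clo lh hd] := lohi i (ltn_ord i).
  rewrite /h integral_indic//= setIidl; last first.
    move=> x /=; rewrite /D /= !in_itv /= => /andP[l1 l2].
    by rewrite (le_trans clo (ltW l1)) (le_trans (ltW l2) hd).
  rewrite /mu lebesgue_measure_itv /= lte_fin.
  by move: lh; rewrite le_eqVlt => /orP[/eqP ->|->//]; rewrite ltxx subrr.
rewrite -lee_fin -eqS -eqK; apply: ge0_le_integral => //=.
- by move=> x _; apply: sume_ge0.
- by apply: emeasurable_sum => i; exact: mh.
- move=> x _; rewrite sumEFin lee_fin; apply: le_trans (sK x).
  by apply: ler_sum => i _; rewrite indicE mem_setE in_itv.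
Qed.

(** Each step of the sample that passes from one side of p to the other
    contains an entry point into the vertical line at p, and distinct steps
    have disjoint time intervals. *)
Lemma crossings_le (gamma : R -> C) (V : R) (n : nat) (t : nat -> R) (p : R) :
  curve gamma -> (vf gamma <= V%:E)%E ->
  (forall i, (i < n)%N -> t i \in `[0, 1]) ->
  (forall i, (i.+1 < n)%N -> t i <= t i.+1) ->
  forall x, (forall i, x i = complex.Re (gamma (t i))) ->
  \sum_(i < n.-1) (Num.min (x i) (x i.+1) < p < Num.max (x i) (x i.+1))%R%:R <= V.
Proof.
move=> gc gV t01 tm x xE.
have nle (i : 'I_n.-1) : (i.+1 < n)%N by have := ltn_ord i; lia.
pose l := [set z : C | complex.Re z = p].
pose E i := [set u | t i < u < t i.+1 /\ entry_points gamma l u].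
pose tau i : R := xget 0 (E i).
pose B (i : 'I_n.-1) := Num.min (x i) (x i.+1) < p < Num.max (x i) (x i.+1).
have tauP (i : 'I_n.-1) : B i -> E i (tau i).
  move=> Bi; have [||||u u1 u2] := @vf_line_entry _ gamma p (t i) (t i.+1) gc.
  - by apply: t01; have := nle i; lia.
  - exact: t01.
  - exact: tm.
  - by rewrite -!xE.
  - by apply: (@xgetPex _ 0 (E i)); exists u.
have tmono i k : (i + k < n)%N -> t i <= t (i + k)%N.
  elim: k => [|k ih]; first by rewrite addn0.
  rewrite addnS => ik; apply: le_trans (ih (ltnW ik)) _; exact: tm.
have tauI (i j : 'I_n.-1) : B i -> B j -> (i < j)%N -> tau i < tau j.
  move=> /tauP [/andP[_ h1] _] /tauP [/andP[h2 _] _] ij.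
  apply: lt_trans h1 _; apply: le_lt_trans h2.
  by rewrite -(subnKC ij); apply: tmono; rewrite subnKC//; have := nle j; lia.
have le1 : (((size [seq tau (val i) | i <- enum B])%:R : R)%:E <= vf gamma)%E.
  apply: le_trans (vf_line_le gamma (vertical_line p)).
  apply: counting_ge_seq.
    rewrite map_inj_in_uniq ?enum_uniq// => i j.
    rewrite !mem_enum => Bi Bj e; apply/val_inj => /=.
    by case: (ltngtP i j) => // ij;
      [have := tauI _ _ Bi Bj ij|have := tauI _ _ Bj Bi ij]; rewrite e ltxx.
  by move=> u /mapP [j]; rewrite mem_enum => /tauP [_ ?] ->.
move: (le_trans le1 gV); rewrite lee_fin; apply: le_trans.
rewrite size_map -cardE -sum1_card natr_sum [leRHS]big_mkcond /=.
by apply: ler_sum => i _; rewrite /in_mem /= /B; case: ifP.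
Qed.

(** A segment of the real axis as a set of complex numbers, in the form in
    which well-boundedness refers to it. *)
Definition seg (a b : R) : set C := [set x%:C | x in `[a, b]].

Lemma segP a b (z : seg a b) :
  a <= complex.Re (set_val z) <= b /\ set_val z = (complex.Re (set_val z))%:C.
Proof.
have [x xab xz] := set_valP z; have -> : set_val z = x%:C := esym xz.
by move: xab => /=; rewrite in_itv.
Qed.

Lemma seg_neq0 a b : a <= b -> seg a b !=set0.
Proof. by move=> ab; exists a%:C; exists a => //=; rewrite in_itv /= lexx. Qed.

(** A step of the sample whose values enclose a level y has, by the
    intermediate value theorem, p or q strictly between its end points, so
    it crosses one of two vertical lines. Hence at most twice vf gamma
    steps enclose y, and integrating over y in [c, d] bounds the sum of the
    jumps. *)
Lemma banach_indicatrix (a b c d : R) (F : R -> R) (f : seg a b -> C) :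
  (forall z, f z = (F (complex.Re (set_val z)))%:C) ->
  continuous F -> c <= d ->
  (forall x, a <= x <= b -> c <= F x <= d) ->
  (forall y, exists p q, forall x, a <= x <= b -> F x = y -> x = p \/ x = q) ->
  var_le f (2 * (d - c)).
Proof.
move=> fF Fc cd Fcd lev gamma V gc gV n t s [t01 tm st].
pose x i := complex.Re (gamma (t i)).
have xs i : (i < n)%N -> complex.Re (set_val (s i)) = x i.
  by move=> ni; rewrite /x st.
have xab i : (i < n)%N -> a <= x i <= b.
  by move=> ni; rewrite -xs//; case: (segP (s i)).
have nle (i : 'I_n.-1) : ((i < n)%N * (i.+1 < n)%N)%type.
  by have := ltn_ord i; split; lia.
have -> : jumps f n s = \sum_(i < n.-1)
    (Num.max (F (x i)) (F (x i.+1)) - Num.min (F (x i)) (F (x i.+1))).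
  apply: eq_bigr => i _; rewrite !fF !xs ?nle// -rmorphB modulusR.
  have [le|/ltW le] := leP (F (x i)) (F (x i.+1)).
    by rewrite ger0_norm// subr_ge0.
  by rewrite ler0_norm ?subr_le0// opprB.
rewrite mulrAC; apply: (@sum_lengths_le n.-1
  (fun i => Num.min (F (x i)) (F (x i.+1)))
  (fun i => Num.max (F (x i)) (F (x i.+1)))) => //.
  move=> i ni; have [ni1 ni2] := nle (Ordinal ni).
  have /andP[? ?] := Fcd _ (xab i ni1); have /andP[? ?] := Fcd _ (xab _ ni2).
  by have [le|/ltW le] := leP (F (x i)) (F (x i.+1)).
move=> y; have [p [q pq]] := lev y.
apply: (@le_trans _ _ (\sum_(i < n.-1)
   ((Num.min (x i) (x i.+1) < p < Num.max (x i) (x i.+1))%R%:R +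
    (Num.min (x i) (x i.+1) < q < Num.max (x i) (x i.+1))%R%:R))); last first.
  rewrite big_split /= mulrDl mul1r.
  by rewrite lerD// (@crossings_le gamma V n t).
apply: ler_sum => i _; have [ni1 ni2] := nle i.
have [yi|_] := boolP (_ < y < _); last by rewrite addr_ge0.
(* The end points of the step are excluded because y lies strictly between
   the values there. *)
have strict u : F u = y -> (u != x i) /\ (u != x i.+1).
  move=> Fu; split; apply/eqP => e; move: yi;
    by rewrite -Fu e gt_min lt_max !ltxx /= ?orbF lt_asym.
have [u ui Fu] : exists2 u,
    Num.min (x i) (x i.+1) < u < Num.max (x i) (x i.+1) & F u = y.
  have [le|/ltW le] := leP (x i) (x i.+1).
    have [||u ui Fu] := @IVT R F (x i) (x i.+1) y le.
    - exact: continuous_subspaceT.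
    - by case/andP: yi => y1 y2; rewrite !ltW.
    have [u1 u2] := strict u Fu.
    exists u => //; rewrite lt_neqAle [u < _]lt_neqAle; move/itvP: ui => ui.
    by rewrite !ui !andbT eq_sym u1.
  have [||u ui Fu] := @IVT R F (x i.+1) (x i) y le.
  - exact: continuous_subspaceT.
  - by rewrite minC maxC; case/andP: yi => y1 y2; rewrite !ltW.
  have [u1 u2] := strict u Fu.
  exists u => //; rewrite lt_neqAle [u < _]lt_neqAle; move/itvP: ui => ui.
  by rewrite !ui !andbT eq_sym u2.
have uab : a <= u <= b.
  have /andP[a1 b1] := xab _ ni1; have /andP[a2 b2] := xab _ ni2.
  case/andP: ui => /ltW u1 /ltW u2.
  by rewrite (le_trans _ u1) ?(le_trans u2)// ?ge_max ?le_min ?a1 ?b1.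
by case: (pq u uab Fu) => <-; rewrite ui /= (lerDl, lerDr).
Qed.

Lemma lambda_seg_bv (a b : R) : a <= b ->
  bv_le (@lambda R (seg a b)) (`|a| + `|b|) (2 * (b - a)).
Proof.
move=> ab; split; rewrite ?addr_ge0 ?mulr_ge0 ?subr_ge0//.
  move=> z; have [/andP[az zb] ez] := segP z.
  rewrite /lambda ez modulusR ler_norml; have := ler_norm b; have := ler_norm (- a).
  by rewrite normrN; have := normr_ge0 a; have := normr_ge0 b => *;
    apply/andP; split; lra.
apply: (@banach_indicatrix a b a b id) => //.
- by move=> z; have [_ ez] := segP z; exact: ez.
- by move=> x; exact: cvg_id.
- by move=> y; exists y, y => x _ ->; left.
Qed.

Lemma lambda_bar_seg (a b : R) : @lambda_bar R (seg a b) = @lambda R (seg a b).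
Proof.
apply/funext => z; rewrite /lambda_bar /lambda; have [_ ->] := segP z.
exact: conjc_real.
Qed.

Lemma AC_seg (a b : R) : a <= b -> closed_subalgebra (@AC_space R (seg a b)).
Proof.
move=> ab; have h := bv_le_BV (lambda_seg_bv ab).
by apply: AC_closed_subalgebra; rewrite ?lambda_bar_seg//; exact: seg_neq0.
Qed.

Lemma AC_gen (sigma : set C) (f : sigma -> C) :
  [\/ f = 1, f = @lambda _ _ | f = @lambda_bar _ _] -> AC_space f.
Proof. by move=> fg A [_]; apply. Qed.

Lemma AC_BV (sigma : set C) (f : sigma -> C) :
  closed_subalgebra (@AC_space R sigma) -> AC_space f -> BV_space f.
Proof. by case=> h _ _ _ _; exact: h. Qed.

Lemma AC_exp (sigma : set C) (f : sigma -> C) n :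
  closed_subalgebra (@AC_space R sigma) -> AC_space f -> AC_space (f ^+ n).
Proof.
move=> [_ h1 [_ hM] _ _] fA; elim: n => [|n ih]; first by rewrite expr0.
by rewrite exprS; exact: hM.
Qed.

(** The polynomial 1 - ((x - p) / L)^2, written with the operations of the
    function algebra so that membership in AC and the action of a
    homomorphism on it follow from the algebra laws. *)
Definition parabola (a b p L : R) : seg a b -> C :=
  1 + (- L ^- 2)%:C *: ((@lambda R (seg a b) + (- p%:C) *: (1 : seg a b -> C)) ^+ 2).

Definition bump (a b p L : R) (k : nat) : seg a b -> C := parabola p L ^+ k.+1.

Lemma fctX (T : Type) (f : T -> C) n x : (f ^+ n) x = f x ^+ n.
Proof. by elim: n => [|n ih] //; rewrite !exprS -ih. Qed.

Lemma bumpE a b p L k (z : seg a b) :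
  bump p L k z = ((1 - ((complex.Re (set_val z) - p) / L) ^+ 2) ^+ k.+1)%:C.
Proof.
rewrite /bump fctX rmorphXn; congr (_ ^+ _).
have -> : parabola p L z = 1 + (- L ^- 2)%:C * (set_val z + - p%:C * 1) ^+ 2 by [].
have [_ ez] := segP z; rewrite {1}ez mulr1 expr_div_n; ring.
Qed.

Lemma bump_AC a b p L k : a <= b -> AC_space (@bump a b p L k).
Proof.
move=> ab; have AC := AC_seg ab; apply: AC_exp => //.
case: (AC) => _ A1 [AD AM] AZ _.
apply: (AD) => //; apply: (AZ); apply: AC_exp => //.
by apply: (AD); [apply: AC_gen; exact: Or32|exact: AZ].
Qed.

(** On the segment the parabola has values in [0, 1], so its powers take
    each value at most at two points, which are symmetric about p. The
    bound does not depend on k, whereas the powers concentrate at p. *)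
Lemma bump_bv a b p L k : 0 < L -> (forall x, a <= x <= b -> `|x - p| <= L) ->
  bv_le (@bump a b p L k) 1 2.
Proof.
move=> L0 pL; pose g x := 1 - ((x - p) / L) ^+ 2.
have g01 x : a <= x <= b -> 0 <= g x <= 1.
  move=> /pL xL; rewrite /g subr_ge0 gerBl sqr_ge0 andbT.
  rewrite -[leLHS](ger0_norm (sqr_ge0 _)) normrX expr_le1// normrM normfV.
  by rewrite (gtr0_norm L0) ler_pdivrMr// mul1r xL.
have h01 x : a <= x <= b -> 0 <= g x ^+ k.+1 <= 1.
  by move=> /g01 /andP[g0 g1]; rewrite exprn_ge0//= exprn_ile1.
split => //.
  move=> z; have [zab _] := segP z; rewrite bumpE modulusR.
  by have /andP[h0 h1] := h01 _ zab; rewrite ger0_norm.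
rewrite -[2]mulr1 -[X in _ * X](subr0 (1 : R)).
apply: (@banach_indicatrix a b 0 1 (fun x => g x ^+ k.+1)) => //.
- by move=> z; exact: bumpE.
- move=> x; apply: (@continuous_comp _ _ _ g (fun y : R => y ^+ k.+1)); last first.
    exact: exprn_continuous.
  apply: cvgB; first exact: cvg_cst.
  apply: (@continuous_comp _ _ _ (fun x : R => (x - p) / L) (fun y : R => y ^+ 2)).
    by apply: cvgM; [apply: cvgB; [exact: cvg_id|exact: cvg_cst]|exact: cvg_cst].
  exact: exprn_continuous.
- move=> y; have [[x0 x0ab <-]|no] :=
    pselect (exists2 x0, a <= x0 <= b & g x0 ^+ k.+1 = y); last first.
    by exists 0, 0 => x xab xy; case: no; exists x.
  exists x0, (2 * p - x0) => x xab /eqP.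
  have /andP[gx _] := g01 _ xab; have /andP[gx0 _] := g01 _ x0ab.
  rewrite eqrXn2// => /eqP /addrI /oppr_inj /eqP.
  rewrite eqf_sqr -mulNr => /orP[]/eqP/divIf => /(_ (lt0r_neq0 L0)) e.
    by left; lra.
  by right; lra.
Qed.

End Indicatrix.

(** * Pulling functions on a segment back along a real linear form *)

Section Projection.
Variable R : realType.
Local Notation C := R[i].
Variables (al be : R).

Definition linform (z : C) : R := al * complex.Re z + be * complex.Im z.

Lemma linform_lipschitz (z w : C) : `|linform z - linform w| <= (`|al| + `|be|) * modulus (z - w).
Proof.
have -> : linform z - linform w = al * complex.Re (z - w) + be * complex.Im (z - w).
  by rewrite /linform !raddfB /=; ring.
rewrite (le_trans (ler_normD _ _))// mulrDl !normrM.
by rewrite lerD// ler_wpM2l// (Re_le_modulus, Im_le_modulus).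
Qed.

Lemma linform_uniform (e : R) : 0 < e -> exists2 d : R, 0 < d &
  forall z w, modulus (z - w) < d -> `|linform z - linform w| < e.
Proof.
move=> e0; have k0 : 0 < `|al| + `|be| + 1 by rewrite ltr_wpDl// addr_ge0.
exists (e / (`|al| + `|be| + 1)); first by rewrite divr_gt0.
move=> z w; rewrite ltr_pdivlMr// => h.
rewrite (le_lt_trans (linform_lipschitz _ _))// (le_lt_trans _ h)// mulrC.
by rewrite ler_wpM2l ?modulus_ge0// lerDl.
Qed.

Lemma linform_continuous : continuous linform.
Proof.
move=> z; apply/(@cvgrPdist_lt _ _ _ (nbhs z)) => e e0.
have [d d0 hd] := linform_uniform e0; apply/nbhs_ballP.
exists d%:C => /=; first by rewrite ltcR.
by move=> w /=; rewrite -ball_normE /= normE ltcR => /hd.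
Qed.

Lemma linform_bounded (sigma : set C) : compact sigma ->
  exists2 L : R, 0 < L & forall z, sigma z -> - L <= linform z <= L.
Proof.
move=> cs; have : compact (linform @` sigma).
  apply: continuous_compact => //; apply: continuous_subspaceT.
  exact: linform_continuous.
move=> /compact_bounded [M [Mr hM]].
exists (`|M| + 1); first by rewrite ltr_wpDl.
move=> z sz; rewrite -ler_norml; apply: (hM (`|M| + 1)); last by exists z.
by rewrite (le_lt_trans (ler_norm _))// ltrDl.
Qed.

Hypothesis albe : al != 0 \/ be != 0.

Lemma curve_linform (gamma : R -> C) :
  curve gamma -> curve (fun t => (linform (gamma t))%:C).
Proof.
move=> /curveP gc; apply/curveP => t t01 e e0.
have [d d0 hd] := linform_uniform e0; have [r r0 hr] := gc t t01 d d0.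
by exists r => // s s01 ts; rewrite -rmorphB modulusR; apply/hd/hr.
Qed.

(** The projected curve is real. A line transversal to the real axis meets
    it at one point c / a, and the projected curve enters there when gamma
    enters the level line of the linear form. A line parallel to the real
    axis is entered at most once, at time 0. *)
Lemma vf_linform_le (gamma : R -> C) :
  (vf (fun t => (linform (gamma t))%:C) <= vf gamma)%E.
Proof.
apply: ge_ereal_sup => _ [_ [a [b [c [_ ->]]]] <-].
have [a0|a0] := eqVneq a 0.
  apply: le_trans (vf_ge1 gamma); apply: (@counting_le1 _ _ _ 0).
  move=> t [_ /= ht [->//|/(_ 1 ltr01)[s [_ _ /= []]]]].
  by move: ht; rewrite a0 !mul0r !mulr0.
have ll : line [set z : C | linform z = c / a] by exists al, be, (c / a).
apply: le_trans (vf_line_le gamma ll); apply: counting_le.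
have E t : (a * linform (gamma t) + b * 0 = c) <-> (linform (gamma t) = c / a).
  rewrite mulr0 addr0; split=> [<-|->]; first by rewrite mulrAC divff// mul1r.
  by rewrite mulrCA divff// mulr1.
move=> t [t01 /= /E ht h]; split => //.
case: h => [->|h]; first by left.
right => e /h [s [s1 s2 /= s3]]; exists s; split => //= /E.
by move=> /s3.
Qed.

Variables (sigma : set C) (a b : R).
Hypothesis linform_ab : forall z, sigma z -> a <= linform z <= b.

Lemma proj_subproof (z : sigma) : (linform (set_val z))%:C \in seg a b.
Proof.
apply/mem_set; exists (linform (set_val z)) => //=.
by rewrite in_itv /=; apply: linform_ab; exact: set_valP.
Qed.

Definition proj (z : sigma) : seg a b := SigSub (proj_subproof z).

Lemma bv_le_proj (f : seg a b -> C) F K : bv_le f F K -> bv_le (f \o proj) F K.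
Proof.
move=> [F0 K0 fF fK]; split => //; first by move=> z; exact: fF.
move=> gamma V gc gV n t s [s1 s2 s3].
apply: (fK _ V (curve_linform gc) (le_trans (vf_linform_le gamma) gV) n t (proj \o s)).
by split => // j jn /=; rewrite -s3.
Qed.

Lemma lambda_proj : @lambda R (seg a b) \o proj =
  ((al / 2) -i* (be / 2)) *: @lambda R sigma +
  ((al / 2) +i* (be / 2)) *: @lambda_bar R sigma.
Proof.
apply/funext => z; set w := set_val z.
transitivity (((al / 2) -i* (be / 2)) * w + ((al / 2) +i* (be / 2)) * w^*);
  last by [].
transitivity (linform w)%:C; first by [].
case: w => x y; apply/eqP; rewrite eq_complex /linform /=.
by apply/andP; split; apply/eqP; field.
Qed.

(** The functions f in BV of the segment whose pull-back lies in a given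
    closed subalgebra over sigma form a closed subalgebra over the segment:
    the pull-back is an algebra morphism that does not increase the norm. *)
Lemma AC_proj (f : seg a b -> C) :
  sigma !=set0 -> AC_space f -> AC_space (f \o proj).
Proof.
move=> s0; have [s1 ss] := s0.
have ab : a <= b.
  by have /andP[] := linform_ab ss; exact: le_trans.
have j0 := seg_neq0 ab.
have [_ B1 [BD BM] BZ _] := BV_closed_subalgebra j0.
move=> fAC A [Acl Agen]; have [AB A1 [AD AM] AZ Acl'] := Acl.
have [|] := fAC [set g | BV_space g /\ A (g \o proj)]; last by [].
split; first split.
- by move=> g [].
- by split => //; exact: A1.
- split=> g h [gB gA] [hB hA]; split.
  + exact: BD.
  + exact: (AD _ _ gA hA).
  + exact: BM.
  + exact: (AM _ _ gA hA).
- by move=> c g [gB gA]; split; [exact: BZ|exact: (AZ c _ gA)].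
- move=> g gB app; split => //.
  have [F [K [gFK _]]] := BV_bv_le j0 gB.
  apply: Acl'; first exact: bv_le_BV (bv_le_proj gFK).
  move=> e e0; have [h [hB hA] gh] := app e e0.
  exists (h \o proj) => //.
  have ghB : BV_space (g - h) by rewrite /BV_space /= (lt_trans gh)// ltry.
  have [F' [K' [dFK eFK]]] := BV_bv_le j0 ghB.
  apply: le_lt_trans (bv_le_norm (bv_le_proj dFK)) _.
  rewrite -eFK; move: gh.
  have := sup_norm_ge0 (g - h) j0; have := var_ge0 (g - h) j0.
  by rewrite /BV_norm; case: (var _) (sup_norm _) => [x| |] [y| |].
- move=> _ [->|->|->].
  + by split; [exact: B1|exact: A1].
  + split; first exact: bv_le_BV (lambda_seg_bv ab).
    rewrite lambda_proj; apply: AD; apply: AZ; apply: Agen.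
      exact: Or32.
    exact: Or33.
  + rewrite lambda_bar_seg; split; first exact: bv_le_BV (lambda_seg_bv ab).
    rewrite lambda_proj; apply: AD; apply: AZ; apply: Agen.
      exact: Or32.
    exact: Or33.
Qed.

Lemma hom_proj (X : completeNormedModType C)
    (psi : (sigma -> C) -> {linear X -> X}) :
  sigma !=set0 -> bounded_unital_hom psi ->
  bounded_unital_hom (fun f : seg a b -> C => psi (f \o proj)).
Proof.
move=> s0 [pc p1 [pD pM] pZ [M pb]].
have ab : a <= b.
  by have [s1 ss] := s0; have /andP[] := linform_ab ss; exact: le_trans.
split.
- by move=> f fA; apply: pc; exact: AC_proj.
- exact: p1.
- by split=> f g fA gA x; [apply: pD|apply: pM]; exact: AC_proj.
- by move=> c f fA x; apply: pZ; exact: AC_proj.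
- exists `|M| => f fA x.
  have fB : BV_space f by apply: AC_BV fA; exact: AC_seg.
  have [F [K [fFK ->]]] := BV_bv_le (seg_neq0 ab) fB.
  apply: le_trans (pb _ (AC_proj s0 fA) x) _; apply: ler_wpM2r => //.
  rewrite lecR; have h := bv_le_fine s0 (bv_le_proj fFK).
  have h0 : 0 <= fine (BV_norm (f \o proj)).
    apply: fine_ge0; apply: adde_ge0; [exact: sup_norm_ge0|exact: var_ge0].
  apply: le_trans (ler_wpM2r h0 (ler_norm M)) _.
  exact: ler_wpM2l.
Qed.

End Projection.

(** * Real parts of an operator with a functional calculus *)

Section Operators.
Variables (R : realType) (X : completeNormedModType R[i]).
Local Notation C := R[i].

Lemma well_bounded_linform (sigma : set C) (psi : (sigma -> C) -> {linear X -> X})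
    (al be : R) :
  sigma !=set0 -> compact sigma -> bounded_unital_hom psi -> (al != 0 \/ be != 0) ->
  AC_space (fun z : sigma => (linform al be (set_val z))%:C) /\
  well_bounded (psi (fun z => (linform al be (set_val z))%:C)).
Proof.
move=> s0 cs hpsi albe; have [L L0 linform_L] := linform_bounded al be cs.
have LL : - L <= L by lra.
have hom := hom_proj albe linform_L s0 hpsi.
have lAC : AC_space (@lambda R (seg (- L) L)) by apply: AC_gen; exact: Or32.
have linform_AC := AC_proj albe linform_L s0 lAC.
split; first exact: linform_AC.
exists (- L), L; split => //; split.
  by case: hpsi => pc _ _ _ _; apply: pc; exact: linform_AC.
by exists (fun f : seg (- L) L -> C => psi (f \o proj linform_L)).
Qed.

(** The operators A, B and D are the images under the calculus of Re, Im
    and Re - Im. *)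
Lemma AC_sigma_real_parts (sigma : set C) (T : {linear X -> X}) :
  sigma !=set0 -> compact sigma -> AC_sigma_operator sigma T ->
  exists A B D : {linear X -> X},
    [/\ well_bounded A, well_bounded B, well_bounded D,
        (forall x, A (B x) = B (A x)) /\ (forall x, T (A x) = A (T x)) &
        (forall x, T x = A x + 'i *: B x) /\ (forall x, D x = A x - B x)].
Proof.
move=> s0 cs [Tc [psi [hpsi psiT]]].
have o0 : (1 : R) != 0 by exact: oner_neq0.
have [fA wA] := @well_bounded_linform _ psi 1 0 s0 cs hpsi (or_introl o0).
have [gA wB] := @well_bounded_linform _ psi 0 1 s0 cs hpsi (or_intror o0).
have [hA wD] := @well_bounded_linform _ psi 1 (-1) s0 cs hpsi (or_introl o0).
set f := (fun z : sigma => _) in fA wA.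
set g := (fun z : sigma => _) in gA wB.
set h := (fun z : sigma => _) in hA wD.
have lA : AC_space (@lambda R sigma) by apply: AC_gen; exact: Or32.
have [pc p1 [pD pM] pZ _] := hpsi.
have comm (u v : sigma -> C) : AC_space u -> AC_space v ->
    forall x, psi u (psi v x) = psi v (psi u x).
  by move=> uA vA x; rewrite -!pM// mulrC.
have ZA (c : C) (u : sigma -> C) : AC_space u -> AC_space (c *: u).
  by move=> uA A Ac; case: (Ac) => -[_ _ _ AZ _] _; apply: AZ; exact: uA.
exists (psi f), (psi g), (psi h); split => //.
  by split=> x; [exact: comm|rewrite -!psiT comm].
split=> x.
  rewrite -psiT -(pZ _ _ gA) -(pD _ _ fA (ZA _ _ gA)).
  congr (psi _ _); apply/funext => z.
  transitivity (f z + 'i * g z); last by [].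
  rewrite /f /g /linform !mul1r !mul0r addr0 add0r; exact: complexE.
have -> : h = f + (-1) *: g.
  apply/funext => z; transitivity (f z + -1 * g z); last by [].
  by rewrite /f /g /h /linform !mul1r !mul0r addr0 add0r !mulN1r -rmorphB.
by rewrite (pD _ _ fA (ZA _ _ gA)) (pZ _ _ gA) scaleN1r.
Qed.

Section Calculus.
Variables (a b : R) (phi : (seg a b -> C) -> {linear X -> X}).
Hypotheses (ab : a <= b) (hphi : bounded_unital_hom phi).

(** On an eigenvector a homomorphism acts on polynomials by evaluation at
    the eigenvalue, even when the eigenvalue is not in the segment. *)
Lemma hom_bump_eigen (u : C) (e : X) p L k :
  phi (@lambda R (seg a b)) e = u *: e ->
  phi (bump p L k) e = (1 - ((u - p%:C) / L%:C) ^+ 2) ^+ k.+1 *: e.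
Proof.
move=> ue; have [pc p1 [pD pM] pZ _] := hphi; have AC := AC_seg ab.
have [_ A1 [AD AM] AZ _] := AC.
have expE (f : seg a b -> C) c n : AC_space f -> phi f e = c *: e ->
    phi (f ^+ n) e = c ^+ n *: e.
  move=> fA fe; elim: n => [|n ih]; first by rewrite expr0 p1 scale1r.
  rewrite exprS pM//; last exact: AC_exp.
  by rewrite ih linearZ /= fe scalerA -exprSr.
have lA : AC_space (@lambda R (seg a b)) by apply: AC_gen; exact: Or32.
pose q := @lambda R (seg a b) + (- p%:C) *: (1 : seg a b -> C).
have qA : AC_space q by apply: AD => //; exact: AZ.
have qe : phi q e = (u - p%:C) *: e.
  by rewrite pD ?pZ ?p1 ?ue -?scalerDl//; exact: AZ.
have q2A : AC_space (q ^+ 2) by exact: AC_exp.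
apply: (expE).
  by apply: AD => //; exact: AZ.
rewrite pD//; last exact: AZ.
rewrite p1 pZ// (expE _ _ _ qA qe) scalerA -[X in X + _]scale1r -scalerDl.
by congr (_ *: e); rewrite expr_div_n rmorphN fmorphV rmorphXn /= mulNr mulrC.
Qed.

(** The bumps have BV norm at most 1 + 2, so a bounded homomorphism bounds
    their images uniformly in k. *)
Lemma hom_bump_bound : exists2 M : R, 0 <= M & forall p L k (x : X), 0 < L ->
  (forall y, a <= y <= b -> `|y - p| <= L) ->
  `|phi (bump p L k) x| <= M%:C * `|x|.
Proof.
have [_ _ _ _ [M hM]] := hphi.
exists (`|M| * (1 + 2)); first by rewrite mulr_ge0.
move=> p L k x L0 hL; apply: le_trans (hM _ (bump_AC p L k ab) x) _.
apply: ler_wpM2r => //; rewrite lecR.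
have j0 := seg_neq0 ab; have bb := bump_bv k L0 hL.
have h0 : 0 <= fine (BV_norm (bump p L k : seg a b -> C)).
  by apply: fine_ge0; apply: adde_ge0; [exact: sup_norm_ge0|exact: var_ge0].
apply: le_trans (ler_wpM2r h0 (ler_norm M)) _.
apply: ler_wpM2l => //; exact: bv_le_fine.
Qed.

End Calculus.

Lemma bernoulli (h : R) n : 0 <= h -> 1 + n%:R * h <= (1 + h) ^+ n.
Proof.
move=> h0; elim: n => [|n ih]; first by rewrite mul0r addr0 expr0.
rewrite exprS; apply: le_trans (ler_wpM2l _ ih); last by rewrite addr_ge0.
rewrite -natr1.
have : 0 <= n%:R * h ^+ 2 by rewrite mulr_ge0 ?sqr_ge0.
by nra.
Qed.

(** If the eigenvalue is p + iv, the image of the k-th bump at p multiplies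
    e by (1 + (v / L)^2)^(k + 1), which stays bounded in k only for v = 0. *)
Lemma well_bounded_eigen_real (A : {linear X -> X}) (e : X) (u : C) :
  well_bounded A -> e != 0 -> A e = u *: e -> complex.Im u = 0.
Proof.
move=> [a [b [ab [Ac [phi [hphi phiA]]]]]] e0 Ae.
have ue : phi (@lambda R (seg a b)) e = u *: e by rewrite phiA.
have [M M0 hM] := hom_bump_bound ab hphi.
case: u Ae ue => p v Ae ue /=; apply: contrapT => /eqP v0.
(* Any L > 0 at least as large as the distance from p to the points of [a,
   b] serves here. *)
pose L := `|a| + `|b| + `|p| + 1.
have L0 : 0 < L by rewrite ltr_wpDl// !addr_ge0.
have hL y : a <= y <= b -> `|y - p| <= L.
  move=> /andP[ay yb]; rewrite ler_norml /L.
  have := ler_norm b; have := ler_norm (- a); have := ler_norm p.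
  have := ler_norm (- p); rewrite !normrN => *.
  have := normr_ge0 a; have := normr_ge0 b => *.
  by apply/andP; split; lra.
clearbody L; pose h := (v / L) ^+ 2.
have h0 : 0 < h by rewrite exprn_even_gt0//= mulf_neq0// invr_eq0 gt_eqF.
have bnd k : (1 + h) ^+ k.+1 <= M.
  have := hM p L k e L0 hL; rewrite (hom_bump_eigen ab hphi p L k ue) normrZ.
  rewrite ler_pM2r ?normr_gt0// normE lecR; apply: le_trans.
  have -> : 1 - ((p +i* v - p%:C) / L%:C) ^+ 2 = (1 + h)%:C.
    have -> : p +i* v - p%:C = 'i * v%:C.
      by rewrite [p +i* v]complexE /= addrAC subrr add0r.
    rewrite /h !expr_div_n exprMn sqr_i rmorphD rmorph1 fmorph_div !rmorphXn /=.
    by rewrite mulN1r mulNr opprK.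
  by rewrite -rmorphXn modulusR ler_norm.
have := bernoulli (Num.truncn (M / h)).+1 (ltW h0).
have := truncnS_gt (M / h); rewrite ltr_pdivrMr// => M1 M2.
have := bnd (Num.truncn (M / h)); lra.
Qed.

End Operators.

(** * The space of sequences of bounded variation *)

Section SequenceVariation.
Variable R : realType.
Local Notation C := R[i].
Implicit Types x y m : nat -> C.

(** The variation norm of the first N + 1 terms. The norm of a sequence is
    the supremum over N, which turns estimates into finite sums. *)
Definition varN (N : nat) x : R :=
  modulus (x 0%N) + \sum_(i < N) modulus (x i.+1 - x i).

Lemma varN_ge0 N x : 0 <= varN N x.
Proof. by rewrite addr_ge0 ?modulus_ge0// sumr_ge0// => j _; exact: modulus_ge0. Qed.

Lemma varND N x y : varN N (x + y) <= varN N x + varN N y.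
Proof.
rewrite /varN addrACA -big_split /= lerD ?modulusD//; apply: ler_sum => j _.
rewrite (_ : _ - _ = x j.+1 - x j + (y j.+1 - y j)) ?modulusD//.
by rewrite addrACA -opprD.
Qed.

Lemma varNZ N (c : C) x : varN N (c *: x) = modulus c * varN N x.
Proof.
rewrite /varN mulrDr mulr_sumr -modulusM; congr (_ + _).
by apply: eq_bigr => j _; rewrite -modulusM mulrBr.
Qed.

Lemma modulus_le_varN n N x : (n <= N)%N -> modulus (x n) <= varN N x.
Proof.
move=> nN; apply: (@le_trans _ _ (varN n x)).
  elim: n {nN} => [|n ih]; first by rewrite /varN big_ord0 addr0.
  rewrite /varN big_ord_recr /= addrA -/(varN n x).
  have -> : modulus (x n.+1) = modulus (x n + (x n.+1 - x n)).
    by congr modulus; ring.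
  by rewrite (le_trans (modulusD _ _))// lerD2r.
rewrite lerD2l -(subnKC nN) big_split_ord /= lerDl.
by apply: sumr_ge0 => j _; exact: modulus_ge0.
Qed.

Lemma varN_small N x (eta : R) :
  (forall j, (j <= N)%N -> modulus (x j) <= eta) -> varN N x <= (N.*2.+1)%:R * eta.
Proof.
move=> h; apply: (@le_trans _ _ (eta + \sum_(j < N) (eta + eta))).
  rewrite lerD ?h//; apply: ler_sum => j _.
  by rewrite (le_trans (modulusD _ _))// modulusN lerD ?h//; have := ltn_ord j; lia.
rewrite sumr_const card_ord -mulr2n -mulrnA -mulrS mulr_natl.
by rewrite mul2n.
Qed.

(** The Leibniz rule, with the sup norm S and the variation V of the
    multiplier kept apart. *)
Lemma varNM N m x (S V K : R) : 0 <= S -> 0 <= V ->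
  (forall n, modulus (m n) <= S) ->
  \sum_(j < N) modulus (m j.+1 - m j) <= V ->
  (forall n, varN n x <= K) ->
  varN N (m * x) <= (S + V) * K.
Proof.
move=> S0 V0 mS mV xK.
have K0 : 0 <= K := le_trans (varN_ge0 0 x) (xK 0%N).
apply: (@le_trans _ _ (S * varN N x + V * K)); last first.
  by rewrite mulrDl lerD2r ler_wpM2l.
apply: (@le_trans _ _
  (S * varN N x + (\sum_(j < N) modulus (m j.+1 - m j)) * K)); last first.
  by rewrite lerD2l ler_wpM2r.
rewrite /varN mulrDr -addrA lerD//.
  by rewrite modulusM ler_wpM2r ?modulus_ge0.
rewrite mulr_sumr mulr_suml -big_split /=; apply: ler_sum => j _.
have -> : (m * x) j.+1 - (m * x) j = m j.+1 * (x j.+1 - x j) + (m j.+1 - m j) * x j.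
  have -> : (m * x) j.+1 - (m * x) j = m j.+1 * x j.+1 - m j * x j by [].
  by ring.
rewrite (le_trans (modulusD _ _))// !modulusM lerD ?ler_wpM2r ?modulus_ge0//.
by rewrite ler_wpM2l ?modulus_ge0// (le_trans _ (xK j))// modulus_le_varN.
Qed.

(** Membership in the space of sequences of bounded variation, as a boolean
    predicate so that the subtype inherits its vector space structure. *)
Definition bvp : {pred nat -> C} :=
  fun x => `[< exists K, forall N, varN N x <= K >].

Lemma bvpP x : reflect (exists K, forall N, varN N x <= K) (x \in bvp).
Proof. exact: asboolP. Qed.

Lemma bvp_submod_closed : submod_closed bvp.
Proof.
split.
  apply/bvpP; exists 0 => N.
  have -> : (0 : nat -> C) = (0 : C) *: 0 by rewrite scaler0.
  by rewrite varNZ modulus0 mul0r.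
move=> c x y /bvpP [K xK] /bvpP [L yL]; apply/bvpP.
exists (modulus c * K + L) => N; rewrite (le_trans (varND _ _ _))//.
by rewrite lerD// varNZ ler_wpM2l// modulus_ge0.
Qed.

HB.instance Definition _ :=
  GRing.isSubmodClosed.Build C (nat -> C) bvp bvp_submod_closed.

Record bvseq := BVseq { bvval :> nat -> C; bvvalP : bvval \in bvp }.
HB.instance Definition _ := [isSub for bvval].
HB.instance Definition _ := [Choice of bvseq by <:].
HB.instance Definition _ := [SubChoice_isSubLmodule of bvseq by <:].

Definition bvnorm (x : bvseq) : R := sup [set varN N x | N in [set: nat]].

Lemma has_sup_varN (x : bvseq) : has_sup [set varN N x | N in [set: nat]].
Proof.
split; first by exists (varN 0 x), 0%N.
by have /bvpP [K xK] := bvvalP x; exists K => _ [N _ <-].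
Qed.

Lemma varN_le (x : bvseq) N : varN N x <= bvnorm x.
Proof. by apply: sup_upper_bound; [exact: has_sup_varN|exists N]. Qed.

Lemma bvnorm_le (x : bvseq) K : (forall N, varN N x <= K) -> bvnorm x <= K.
Proof.
move=> h; apply: sup_le_ub; first by exists (varN 0 x), 0%N.
by move=> _ [N _ <-].
Qed.

Lemma bvnorm_ge0 (x : bvseq) : 0 <= bvnorm x.
Proof. exact: le_trans (varN_ge0 0 x) (varN_le x 0). Qed.

Lemma bvnormD (x y : bvseq) : bvnorm (x + y) <= bvnorm x + bvnorm y.
Proof.
apply: bvnorm_le => N; apply: le_trans (varND _ _ _) _.
by rewrite lerD ?varN_le.
Qed.

Lemma bvnormZ (c : C) (x : bvseq) : bvnorm (c *: x) = modulus c * bvnorm x.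
Proof.
have le c' (x' : bvseq) : bvnorm (c' *: x') <= modulus c' * bvnorm x'.
  apply: bvnorm_le => N; rewrite [leLHS](varNZ N c' x').
  by rewrite ler_wpM2l ?modulus_ge0// varN_le.
apply/eqP; rewrite eq_le le /=.
have [->|c0] := eqVneq c 0.
  by rewrite modulus0 mul0r bvnorm_ge0.
rewrite -{1}[x](scalerK c0).
apply: (le_trans (ler_wpM2l (modulus_ge0 c) (le _ _))).
by rewrite mulrA -modulusM divff// modulus1 mul1r.
Qed.

Lemma bvnorm_eq0 (x : bvseq) : bvnorm x = 0 -> x = 0.
Proof.
move=> x0; apply/val_inj/funext => n; apply: modulus_eq0; apply/eqP.
rewrite eq_le modulus_ge0 andbT -x0.
exact: le_trans (modulus_le_varN _ (leqnn n)) (varN_le x n).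
Qed.

Lemma bvnormCD (x y : bvseq) : (bvnorm (x + y))%:C <= (bvnorm x)%:C + (bvnorm y)%:C.
Proof. by rewrite -rmorphD lecR bvnormD. Qed.

Lemma bvnormCZ (c : C) (x : bvseq) : (bvnorm (c *: x))%:C = `|c| * (bvnorm x)%:C.
Proof. by rewrite bvnormZ rmorphM normE. Qed.

Lemma bvnormC_eq0 (x : bvseq) : (bvnorm x)%:C = 0 -> x = 0.
Proof. by move=> h; apply: bvnorm_eq0; exact: complexI h. Qed.

HB.instance Definition _ :=
  Lmodule_isNormed.Build C bvseq bvnormCD bvnormCZ bvnormC_eq0.

Lemma bvseq_normE (x : bvseq) : `|x| = (bvnorm x)%:C.
Proof. by []. Qed.

Lemma coord_le (x : bvseq) n : modulus (x n) <= bvnorm x.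
Proof. exact: le_trans (modulus_le_varN _ (leqnn n)) (varN_le x n). Qed.

Lemma bvseqP (x y : bvseq) : (forall n, x n = y n) -> x = y.
Proof. by move=> h; apply/val_inj/funext. Qed.

Lemma bvseqD (x y : bvseq) n : (x + y) n = x n + y n.
Proof. by []. Qed.

Lemma bvseqB (x y : bvseq) n : (x - y) n = x n - y n.
Proof. by []. Qed.

Lemma bvseqZ (c : C) (x : bvseq) n : (c *: x) n = c * x n.
Proof. by []. Qed.

End SequenceVariation.

(** * Completeness and multiplication operators *)

Section SequenceSpace.
Variable R : realType.
Local Notation C := R[i].
Local Notation X := (bvseq R).

Section Completeness.
Variable F : set_system X.
Context {FF : ProperFilter F}.
Hypothesis Fc : cauchy F.

Lemma bvseq_cauchy (e : R) : 0 < e ->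
  exists x : X, F [set y : X | bvnorm (x - y) < e].
Proof.
move=> e0; have e0C : 0 < e%:C by rewrite ltcR.
have [x Fx] := (cauchyP F).1 Fc _ e0C; exists x.
by apply: filterS Fx => y; rewrite -ball_normE /= bvseq_normE ltcR.
Qed.

(** Coordinates are dominated by the norm, so the real and the imaginary
    part of each coordinate is a Cauchy filter of real numbers. *)
Lemma coord_cvg (n : nat) :
  exists c : C, forall e : R, 0 < e -> F [set y : X | modulus (c - y n) < e].
Proof.
have real_cvg (g : C -> R) : (forall z w, `|g z - g w| <= modulus (z - w)) ->
    exists l : R, forall e : R, 0 < e -> F [set y : X | `|l - g (y n)| < e].
  move=> glip; pose G := (fun y : X => g (y n)) @ F.
  have /cvg_ex [l Gl] : cvg G.
    apply: cauchy_cvg; apply: cauchy_exP => e e0.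
    have [x Fx] := bvseq_cauchy e0; exists (g (x n)).
    have : F [set y : X | ball (g (x n)) e (g (y n))]; last by [].
    apply: filterS Fx => y /= xy; rewrite -ball_normE /=.
    exact: le_lt_trans (le_trans (glip (x n) (y n)) (coord_le (x - y) n)) xy.
  exists l => e e0.
  by have /cvgrPdist_lt /(_ e e0) : G --> l by [].
have [|p hp] := real_cvg (@complex.Re R).
  by move=> z w; rewrite -raddfB Re_le_modulus.
have [|q hq] := real_cvg (@complex.Im R).
  by move=> z w; rewrite -raddfB Im_le_modulus.
exists (p +i* q) => e e0; have e2 : 0 < e / 2 by rewrite divr_gt0.
apply: filterS2 (hp _ e2) (hq _ e2) => y /= yp yq.
apply: le_lt_trans (modulus_le_ReIm _) _; rewrite !raddfB /=; lra.
Qed.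

(** For fixed N the N-th partial variation depends on finitely many
    coordinates, so a bound for the distance of x to the members of the
    filter passes to the distance of x to the coordinatewise limit; it is
    uniform in N. *)
Lemma bvseq_lim : exists x : X, forall e : R, 0 < e ->
  F [set y : X | bvnorm (x - y) < e].
Proof.
have [c cF] := choice coord_cvg.
have near_c (N : nat) (eta : R) : 0 < eta ->
    F [set y : X | forall j, (j <= N)%N -> modulus (y j - c j) <= eta].
  move=> eta0; elim: N => [|N ih].
    apply: filterS (cF 0%N _ eta0) => y /= h j; rewrite leqn0 => /eqP ->.
    by rewrite modulusB ltW.
  apply: filterS2 ih (cF N.+1 _ eta0) => y /= h1 h2 j.
  rewrite leq_eqVlt => /orP[/eqP ->|]; last exact: h1.
  by rewrite modulusB ltW.
have close (e : R) (x : X) : F [set y : X | bvnorm (x - y) < e] ->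
    forall N, varN N ((x : nat -> C) - c) <= e.
  move=> Fx N; apply/ler_addgt0Pr => d d0.
  have D0 : 0 < (N.*2.+1)%:R :> R by rewrite ltr0n.
  (* If all coordinates up to N are within eta, the N-th partial variation is
     at most (2 N + 1) eta. *)
  have eta0 : 0 < d / (N.*2.+1)%:R by rewrite divr_gt0.
  have [y [/= xy yc]] := filter_ex (filterI Fx (near_c N _ eta0)).
  have -> : (x : nat -> C) - c = ((x - y : X) : nat -> C) + ((y : nat -> C) - c).
    by rewrite addrA; congr (_ - _); rewrite /= subrK.
  apply: le_trans (varND _ _ _) _; apply: lerD.
    by rewrite (le_trans (varN_le _ _))// ltW.
  apply: le_trans (varN_small yc) _.
  by rewrite mulrCA divff ?mulr1// gt_eqF.
have [x1 Fx1] := bvseq_cauchy ltr01.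
have cbv : c \in @bvp R.
  apply/bvpP; exists (bvnorm x1 + 1) => N.
  have -> : c = (x1 : nat -> C) + (-1 : C) *: ((x1 : nat -> C) - c).
    by rewrite scaleN1r opprB addrC subrK.
  apply: le_trans (varND _ _ _) _; rewrite varNZ modulusN modulus1 mul1r.
  by rewrite lerD ?varN_le// close.
exists (BVseq cbv) => e e0; have e2 : 0 < e / 2 by rewrite divr_gt0.
have [x Fx] := bvseq_cauchy e2.
apply: filterS (Fx) => y /= xy.
have cx : bvnorm (BVseq cbv - x) <= e / 2.
  have -> : BVseq cbv - x = (-1 : C) *: (x - BVseq cbv) by rewrite scaleN1r opprB.
  rewrite bvnormZ modulusN modulus1 mul1r.
  by apply: bvnorm_le => N; exact: close.
have -> : BVseq cbv - y = (BVseq cbv - x) + (x - y) by rewrite addrA subrK.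
apply: le_lt_trans (bvnormD _ _) _; lra.
Qed.

End Completeness.

Lemma bvseq_complete (F : set_system X) : ProperFilter F -> cauchy F -> cvg F.
Proof.
move=> FF Fc; have [x Fx] := bvseq_lim Fc.
apply/cvg_ex; exists x; apply/cvgrPdist_lt => e.
rewrite ltcE /= => /andP[/eqP ime e0].
apply: filterS (Fx _ e0) => y /=; rewrite bvseq_normE -ltcR.
by congr (_ < _); apply/eqP; rewrite eq_complex /= ime !eqxx.
Qed.

HB.instance Definition _ := Uniform_isComplete.Build X bvseq_complete.


Section Multiplication.

Lemma mult_subproof (m x : X) : (m : nat -> C) * (x : nat -> C) \in @bvp R.
Proof.
apply/bvpP; exists ((bvnorm m + bvnorm m) * bvnorm x) => N.
apply: varNM; rewrite ?bvnorm_ge0//.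
- by move=> n; exact: coord_le.
- by apply: le_trans (varN_le m N); rewrite lerDr modulus_ge0.
- by move=> n; exact: varN_le.
Qed.

Definition mult (m x : X) : X := BVseq (mult_subproof m x).

Lemma multE m x n : mult m x n = m n * x n.
Proof. by []. Qed.

Lemma mult_linear m : linear (mult m).
Proof.
move=> c x y; apply: bvseqP => n.
by rewrite bvseqD bvseqZ !multE bvseqD bvseqZ; ring.
Qed.

HB.instance Definition _ m :=
  GRing.isLinear.Build C X X *:%R (mult m) (mult_linear m).

Lemma mult_bound (m x : X) (S V : R) : 0 <= S -> 0 <= V ->
  (forall n, modulus (m n) <= S) ->
  (forall N, \sum_(j < N) modulus (m j.+1 - m j) <= V) ->
  bvnorm (mult m x) <= (S + V) * bvnorm x.
Proof.
move=> S0 V0 mS mV; apply: bvnorm_le => N.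
by apply: varNM => // n; exact: varN_le.
Qed.

Lemma mult_continuous m : continuous (mult m).
Proof.
apply: (@bounded_linear_continuous _ _ _ (mult m)).
apply/linear_boundedP.
exists (bvnorm m + bvnorm m)%:C; split.
  by rewrite complex_real.
move=> r mr x; rewrite !bvseq_normE.
apply: (@le_trans _ _ ((bvnorm m + bvnorm m)%:C * (bvnorm x)%:C)).
  rewrite -rmorphM lecR; apply: mult_bound; rewrite ?bvnorm_ge0//.
  - by move=> n; exact: coord_le.
  - by move=> N; apply: le_trans (varN_le m N); rewrite lerDr modulus_ge0.
by rewrite ler_wpM2r ?ler0c ?bvnorm_ge0// ltW.
Qed.

End Multiplication.
End SequenceSpace.

(** * The zigzag multiplier *)

Section MonotoneMultipliers.
Variable R : realType.
Local Notation C := R[i].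
Local Notation X := (bvseq R).

Definition unit_path : R -> C := fun t => t%:C.

Lemma curve_unit_path : curve unit_path.
Proof.
apply/curveP => t _ e e0; exists e => // s _.
by rewrite /unit_path -rmorphB modulusR.
Qed.

(** A line other than the real axis meets the path once, and the real axis
    is entered only at time 0. *)
Lemma vf_unit_path : (vf unit_path <= 1%:E)%E.
Proof.
apply: ge_ereal_sup => _ [_ [a [b [c [_ ->]]]] <-].
have [a0|a0] := eqVneq a 0.
  apply: (@counting_le1 _ _ _ 0) => t [_ /= ht [->//|/(_ 1 ltr01)[s [_ _ /= []]]]].
  by move: ht; rewrite a0 !mul0r !mulr0.
apply: (@counting_le1 _ _ _ (c / a)) => t [_ /= <- _] /=.
by rewrite mulr0 addr0 mulrAC divff// mul1r.
Qed.

Variable a : nat -> R.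
Hypothesis a01 : forall n, 0 <= a n <= 1.
Hypothesis a_nd : forall n, a n <= a n.+1.

Lemma node_subproof n : (a n)%:C \in seg (0 : R) 1.
Proof. by apply/mem_set; exists (a n) => //=; rewrite in_itv /=. Qed.

Definition node n : seg (0 : R) 1 := SigSub (node_subproof n).

(** The monotone sequence a lists the times of a sample of the straight
    path, for which vf is at most 1. *)
Lemma sum_jumps_node (f : seg (0 : R) 1 -> C) F K N : bv_le f F K ->
  \sum_(j < N) modulus (f (node j.+1) - f (node j)) <= K.
Proof.
move=> [_ _ _ fK]; rewrite -[K]mulr1.
apply: (fK _ 1 curve_unit_path vf_unit_path N.+1 a node); split => // j _.
by rewrite in_itv /=.
Qed.

Lemma bvp_node (f : seg (0 : R) 1 -> C) F K : bv_le f F K -> f \o node \in @bvp R.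
Proof.
move=> fFK; apply/bvpP; exists (F + K) => N.
by apply: lerD; [case: fFK => _ _ + _; apply|exact: (sum_jumps_node N fFK)].
Qed.

(** The sequence f(a_n). The default 0 is taken only when it has unbounded
    variation, which does not happen for f in BV. *)
Definition multiplier (f : seg (0 : R) 1 -> C) : X := insubd (0 : X) (f \o node).

Lemma multiplierE f F K n : bv_le f F K -> multiplier f n = f (node n).
Proof.
move=> /bvp_node h.
by rewrite /multiplier -[_ n]/(val (insubd _ _) n) insubdK.
Qed.

(** The bound is the Leibniz rule: the sup norm of f(a_n) is at most that
    of f, and its variation is at most that of f. *)
Lemma multiplier_hom :
  bounded_unital_hom (fun f : seg (0 : R) 1 -> C => mult (multiplier f)).
Proof.
have j0 : seg (0 : R) 1 !=set0 by exact: seg_neq0.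
have AC : closed_subalgebra (@AC_space R (seg 0 1)) by exact: AC_seg.
have [AB A1 [AD AM] AZ _] := AC.
have E f n : AC_space f -> multiplier f n = f (node n).
  by move=> /AB /(BV_bv_le j0) [F [K [fFK _]]]; exact: multiplierE fFK.
split.
- by move=> f _; exact: mult_continuous.
- by move=> x; apply: bvseqP => n; rewrite multE E// mul1r.
- split=> f g fA gA x; apply: bvseqP => n.
    by rewrite bvseqD !multE (E _ _ (AD _ _ fA gA)) !E// -mulrDl.
  by rewrite !multE (E _ _ (AM _ _ fA gA)) !E// mulrA.
- move=> c f fA x; apply: bvseqP => n.
  by rewrite bvseqZ !multE (E _ _ (AZ c _ fA)) !E// mulrA.
- exists 1 => f fA x; have [F [K [fFK ->]]] := BV_bv_le j0 (AB _ fA).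
  rewrite mul1r !bvseq_normE -rmorphM lecR.
  have [F0 K0 fF _] := fFK.
  apply: mult_bound => // [n|N]; first by rewrite E.
  apply: le_trans (sum_jumps_node N fFK); apply: ler_sum => j _.
  by rewrite !E.
Qed.

Definition coeff : X := multiplier (@lambda R (seg 0 1)).

Lemma coeffE n : coeff n = (a n)%:C.
Proof. by rewrite /coeff (multiplierE _ (lambda_seg_bv ler01)). Qed.

Lemma well_bounded_coeff : well_bounded (mult coeff).
Proof.
exists 0, 1; split => //; split; first exact: mult_continuous.
by exists (fun f => mult (multiplier f)); split; [exact: multiplier_hom|].
Qed.

End MonotoneMultipliers.

Section Example.
Variable R : realType.
Local Notation C := R[i].
Local Notation X := (bvseq R).

Definition stair (k : nat) : R := 1 - 2 ^- k.

Lemma stair01 k : 0 <= stair k <= 1.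
Proof.
rewrite /stair subr_ge0 gerBl invr_ge0 exprn_ge0// andbT.
by rewrite invf_le1 ?exprn_gt0// exprn_ege1// ler1n.
Qed.

Lemma stair_nd k l : (k <= l)%N -> stair k <= stair l.
Proof.
move=> kl; rewrite /stair lerB// lef_pV2 ?posrE ?exprn_gt0//.
by rewrite ler_weXn2l// ler1n.
Qed.

Lemma stair_inj : injective stair.
Proof.
have lt k l : (k < l)%N -> stair k < stair l.
  move=> kl; rewrite /stair ltrD2l ltrN2 ltf_pV2 ?posrE ?exprn_gt0//.
  by rewrite ltr_eXn2l// ltr1n.
by move=> k l e; case: (ltngtP k l) => // /lt; rewrite e ltxx.
Qed.

(** The two sequences move in turn: astair on the steps from even to odd
    indices, bstair on the others. *)
Definition astair n := stair (uphalf n).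
Definition bstair n := stair n./2.

Lemma astair_nd n : astair n <= astair n.+1.
Proof. by apply: stair_nd; exact: uphalf_leq. Qed.

Lemma bstair_nd n : bstair n <= bstair n.+1.
Proof. by apply: stair_nd; exact: half_leq. Qed.

Let A : X := @coeff R astair (fun n => stair01 _).
Let B : X := @coeff R bstair (fun n => stair01 _).

Definition eigen n : C := (astair n)%:C + 'i * (bstair n)%:C.

Definition zigzag : X := A + 'i *: B.

Lemma zigzagE n : zigzag n = eigen n.
Proof.
rewrite bvseqD bvseqZ /A /B !coeffE//; [exact: bstair_nd|exact: astair_nd].
Qed.

Lemma Re_eigen n : complex.Re (eigen n) = astair n.
Proof. by rewrite /eigen /=; ring. Qed.

Lemma Im_eigen n : complex.Im (eigen n) = bstair n.
Proof. by rewrite /eigen /=; ring. Qed.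

Lemma eigen_inj : injective eigen.
Proof.
move=> m n e.
have /stair_inj a_eq : astair m = astair n by rewrite -!Re_eigen e.
have /stair_inj b_eq : bstair m = bstair n by rewrite -!Im_eigen e.
move: a_eq; rewrite !uphalf_half => a_eq.
by rewrite -[m]odd_double_half -[n]odd_double_half b_eq; lia.
Qed.

Lemma zigzag_AC_operator : AC_operator (mult zigzag).
Proof.
exists (mult A), (mult B); split.
- exact: well_bounded_coeff astair_nd.
- exact: well_bounded_coeff bstair_nd.
- by move=> x; apply: bvseqP => n; rewrite !multE mulrCA.
- move=> x; apply: bvseqP => n.
  by rewrite bvseqD bvseqZ !multE bvseqD bvseqZ mulrDl mulrA.
Qed.

Definition step_fun (N : nat) : nat -> C := fun n => ((n < N)%N%:R : R)%:C.

Lemma varN_step_fun N M : varN M (step_fun N) <= 2.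
Proof.
have le1 (P : bool) : (P%:R : R) <= 1 by case: P.
have -> : varN M (step_fun N) = (0 < N)%N%:R + ((0 < N)%N%:R - (M < N)%N%:R).
  rewrite /varN modulusR ger0_norm//; congr (_ + _).
  rewrite -opprB -(@telescope_sumr_eq _ 0 M (fun j => (j < N)%N%:R)
    (fun j => - modulus (step_fun N j.+1 - step_fun N j)))//.
    by rewrite sumrN opprK big_mkord.
  move=> j _; rewrite -rmorphB modulusR ler0_norm ?opprK// subr_le0 ler_nat.
  by case: (ltnP j.+1 N) => // /ltnW ->.
have : 0 <= (M < N)%N%:R :> R by rewrite ler0n.
have := le1 (0 < N)%N; lra.
Qed.

Lemma step_fun_bvp N : step_fun N \in @bvp R.
Proof. by apply/bvpP; exists 2 => M; exact: varN_step_fun. Qed.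

Definition step N : X := BVseq (step_fun_bvp N).

Lemma step_norm N : bvnorm (step N) <= 2.
Proof. by apply: bvnorm_le => M; exact: varN_step_fun. Qed.

Definition delta n : X := step n.+1 - step n.

Lemma deltaE n m : delta n m = ((m == n)%:R : R)%:C.
Proof.
rewrite bvseqB /= /step_fun -rmorphB ltnS leq_eqVlt; congr (_%:C).
by case: eqP => [->|] /=; [rewrite ltnn subr0|rewrite subrr].
Qed.

Lemma delta_neq0 n : delta n != 0.
Proof.
apply/eqP => /(congr1 (fun x : X => x n)); rewrite deltaE eqxx => /eqP.
by rewrite eq_complex /= oner_eq0.
Qed.

Lemma sum_delta N : \sum_(n < N) delta n = step N.
Proof.
rewrite -(big_mkord xpredT delta) telescope_sumr//.
have -> : step 0 = 0; last by rewrite subr0.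
by apply: bvseqP.
Qed.

Lemma zigzag_delta n : mult zigzag (delta n) = eigen n *: delta n.
Proof.
apply: bvseqP => m.
rewrite bvseqZ multE zigzagE deltaE; have [->//|_] := eqVneq m n.
by rewrite !mulr0.
Qed.

(** The eigenvalues of the zigzag multiplier are distinct, so its
    eigenspaces are spanned by the unit vectors, and they are invariant
    under S. *)
Lemma commutant_eigen (S : {linear X -> X}) :
  (forall x, mult zigzag (S x) = S (mult zigzag x)) ->
  forall n, S (delta n) = S (delta n) n *: delta n.
Proof.
move=> ST n; apply: bvseqP => m.
rewrite bvseqZ deltaE; have [->|mn] := eqVneq m n; first by rewrite mulr1.
rewrite mulr0; have := congr1 (fun x : X => x m) (ST (delta n)).
rewrite multE zigzagE zigzag_delta linearZ_LR bvseqZ => /eqP.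
rewrite -subr_eq0 -mulrBl mulf_eq0.
by rewrite subr_eq0 (inj_eq eigen_inj) (negbTE mn) /= => /eqP.
Qed.

End Example.

(** * The zigzag operator has no calculus on a plane set *)

Section Counterexample.
Variable R : realType.
Local Notation C := R[i].
Local Notation X := (bvseq R).

Lemma bvseq_sum (I : Type) (r : seq I) (x : I -> X) n :
  (\sum_(j <- r) x j) n = \sum_(j <- r) x j n.
Proof. by apply: (big_morph (fun y : X => y n)). Qed.

Definition gap n : R := astair R n - bstair R n.

Lemma gapE n : gap n = if odd n then 2 ^- n./2.+1 else 0.
Proof.
rewrite /gap /astair /bstair uphalf_half; case: ifP => _ /=; last by rewrite subrr.
rewrite /stair add1n exprS invfM; set t := (2 ^+ n./2)^-1; lra.
Qed.

Lemma eigen_parts_gap (u v : C) (n : nat) :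
  eigen R n = u + 'i * v -> complex.Im u = 0 -> complex.Im v = 0 ->
  u - v = (gap n)%:C.
Proof.
move=> e; have := Re_eigen R n; have := Im_eigen R n; rewrite e /gap => <- <-.
case: u {e} => u1 u2; case: v => v1 v2 /= -> ->.
apply/eqP; rewrite eq_complex /=; apply/andP; split; apply/eqP; ring.
Qed.

(** Commutation with the zigzag operator makes A and B diagonal, and the
    reality of their eigenvalues leaves no freedom in the splitting. *)
Lemma difference_eigen (A B D : {linear X -> X}) :
  well_bounded A -> well_bounded B ->
  (forall x, mult (zigzag R) (A x) = A (mult (zigzag R) x)) ->
  (forall x, mult (zigzag R) x = A x + 'i *: B x) ->
  (forall x, D x = A x - B x) ->
  forall n, D (delta R n) = (gap n)%:C *: delta R n.
Proof.
move=> wA wB TA TE DE n.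
have An := commutant_eigen TA n.
set u := A (delta R n) n in An.
pose v := - 'i * (eigen R n - u).
have i2 : 'i * 'i = -1 :> C by rewrite -expr2 sqr_i.
have Bn : B (delta R n) = v *: delta R n.
  have := TE (delta R n); rewrite zigzag_delta An => /eqP.
  rewrite addrC -subr_eq -scalerBl => /eqP /(congr1 (fun x => (- 'i) *: x)).
  by rewrite !scalerA [X in _ = X *: _]mulNr i2 opprK scale1r => <-.
have uv : eigen R n = u + 'i * v.
  by rewrite /v mulNr mulrN mulrA i2 mulN1r opprK addrC subrK.
have d0 := delta_neq0 R n.
have := eigen_parts_gap uv (well_bounded_eigen_real wA d0 An)
  (well_bounded_eigen_real wB d0 Bn).
by move=> <-; rewrite DE An Bn scalerBl.
Qed.

(** For k h >= 1 one has (1 + h)^k >= 2, while (1 - h)^k (1 + h)^k <= 1. *)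
Lemma power_le_half (h : R) : 0 < h <= 1 -> exists k, (1 - h) ^+ k.+1 <= 2^-1.
Proof.
move=> /andP[h0 h1]; exists (Num.truncn h^-1).
set k := (_.+1).
have kh : 1 <= k%:R * h.
  by rewrite -ler_pdivrMr// mul1r ltW// truncnS_gt.
have two : 2 <= (1 + h) ^+ k.
  by apply: le_trans (bernoulli k (ltW h0)); rewrite (_ : 2 = 1 + 1)// lerD2l.
have g0 : 0 <= (1 - h) ^+ k by rewrite exprn_ge0// subr_ge0.
rewrite -[leRHS]mul1r ler_pdivlMr//; apply: le_trans (ler_wpM2l g0 two) _.
rewrite -exprMn; apply: exprn_ile1.
  by rewrite mulr_ge0 ?subr_ge0// addr_ge0// ltW.
have := sqr_ge0 h; nra.
Qed.

(** Apply the calculus to the bump at 0 of high order and then to the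
    indicator of the first N + 1 indices, which has norm at most 2. The
    result jumps by at least 1/2 at each of the first N steps, yet its norm
    is bounded independently of N. *)
Lemma zigzag_difference_not_well_bounded (D : {linear X -> X}) :
  (forall n, D (delta R n) = (gap n)%:C *: delta R n) -> ~ well_bounded D.
Proof.
move=> Dn [p [q [pq [_ [phi [hphi phiD]]]]]].
have [M M0 hM] := hom_bump_bound pq hphi.
have [L [L1 hL]] : exists L : R, 1 <= L /\ forall y, p <= y <= q -> `|y - 0| <= L.
  exists (`|p| + `|q| + 1); split; first by rewrite lerDr addr_ge0.
  move=> y /andP[py yq]; rewrite subr0 ler_norml.
  have := ler_norm q; have := ler_norm (- p); rewrite normrN => *.
  by have := normr_ge0 p; have := normr_ge0 q => *; apply/andP; split; lra.
have L0 : 0 < L by rewrite (lt_le_trans ltr01).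
(* Large enough that N / 2 exceeds the bound 2 M for the norm of the
   result. *)
pose N := (Num.truncn (4 * M)).+1.
(* All nonzero gaps with index at most N are at least 2 ^- N. *)
pose h := (2 ^- N / L) ^+ 2.
have t0 : 0 < 2 ^- N / L :> R by rewrite divr_gt0// invr_gt0 exprn_gt0.
have tL k : 0 < 2 ^- k / L <= 1.
  rewrite divr_gt0 ?invr_gt0 ?exprn_gt0//= ler_pdivrMr// mul1r.
  by rewrite (le_trans _ L1)// invf_le1 ?exprn_gt0// exprn_ege1// ler1n.
have h01 : 0 < h <= 1.
  by have /andP[t1 t2] := tL N; rewrite exprn_gt0//= exprn_ile1// ltW.
have [k hk] := power_le_half h01.
pose f n : R := (1 - (gap n / L) ^+ 2) ^+ k.+1.
have bump_delta n : phi (bump 0 L k) (delta R n) = (f n)%:C *: delta R n.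
  have e : phi (@lambda R (seg p q)) (delta R n) = (gap n)%:C *: delta R n.
    by rewrite phiD.
  rewrite (hom_bump_eigen pq hphi 0 L k e); congr (_ *: _).
  have -> : (gap n)%:C - 0%:C = (gap n)%:C :> C by rewrite -rmorphB subr0.
  rewrite -fmorph_div -rmorphXn -[X in X - _](rmorph1 (real_complex R)) -rmorphB.
  by rewrite -rmorphXn.
have f_even n : ~~ odd n -> f n = 1.
  by move=> /negbTE on; rewrite /f gapE on mul0r expr0n subr0 expr1n.
have f_odd n : (n <= N)%N -> odd n -> f n <= 2^-1.
  move=> nN on; apply: le_trans hk; have nN' : (n./2.+1 <= N)%N.
    by rewrite (leq_trans _ nN)// -[leqRHS]odd_double_half on -addnn; lia.
  have /andP[/ltW g0 g1] := tL n./2.+1; have /andP[/ltW g2 g3] := tL N.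
  rewrite /f gapE on lerXn2r// ?nnegrE ?subr_ge0 ?exprn_ile1//.
  rewrite lerD2l lerN2 /h lerXn2r ?nnegrE// ler_wpM2r ?invr_ge0 ?(ltW L0)//.
  by rewrite lef_pV2 ?posrE ?exprn_gt0// ler_weXn2l// ler1n.
pose y := phi (bump 0 L k) (step R N.+1).
have yE n : (n <= N)%N -> y n = (f n)%:C.
  move=> nN; rewrite /y -sum_delta linear_sum bvseq_sum.
  have nN1 : (n < N.+1)%N by [].
  rewrite (bigD1 (Ordinal nN1))//= bump_delta bvseqZ deltaE eqxx mulr1.
  rewrite big1 ?addr0// => j jn; rewrite bump_delta bvseqZ deltaE.
  have -> : (n == j) = false.
    by apply/negbTE; move: jn; apply: contra => /eqP e; apply/eqP/val_inj.
  by rewrite mulr0.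
have ynorm : bvnorm y <= M * 2.
  rewrite -lecR -bvseq_normE; apply: le_trans (hM 0 L k _ L0 hL) _.
  by rewrite bvseq_normE -rmorphM lecR ler_wpM2l// step_norm.
have yvar : N%:R * 2^-1 <= bvnorm y.
  apply: le_trans (varN_le y N).
  apply: (@le_trans _ _ (\sum_(j < N) modulus (y j.+1 - y j))); last first.
    by rewrite lerDr modulus_ge0.
  rewrite mulr_natl -[X in _ *+ X]card_ord -sumr_const; apply: ler_sum => j _.
  have jN := ltn_ord j; rewrite !yE//; last exact: ltnW.
  rewrite -rmorphB modulusR; have [oj|oj] := boolP (odd j).
    have := f_odd _ (ltnW jN) oj; rewrite (f_even j.+1) /= ?oj// => fj.
    by apply: le_trans (ler_norm _); lra.
  have := f_odd j.+1 jN oj; rewrite (f_even _ oj) => fj.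
  by rewrite distrC; apply: le_trans (ler_norm _); lra.
have := truncnS_gt (4 * M); rewrite -/N; lra.
Qed.

Lemma zigzag_not_AC_sigma (sigma : set C) :
  sigma !=set0 -> compact sigma -> ~ AC_sigma_operator sigma (mult (zigzag R)).
Proof.
move=> s0 cs /(AC_sigma_real_parts s0 cs) [A [B [D [wA wB wD [_ TA] [TE DE]]]]].
exact: zigzag_difference_not_well_bounded (difference_eigen wA wB TA TE DE) wD.
Qed.

End Counterexample.

Theorem corollary5p6 (R : realType) :
  (forall (X : completeNormedModType R[i]) (T : {linear X -> X}),
     continuous T ->
     (exists sigma : set R[i],
        [/\ sigma !=set0, compact sigma & AC_sigma_operator sigma T]) ->
     AC_operator T) /\
  (exists (X : completeNormedModType R[i]) (T : {linear X -> X}),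
     [/\ continuous T, AC_operator T &
         forall sigma : set R[i], sigma !=set0 -> compact sigma ->
           ~ AC_sigma_operator sigma T]).
Proof.
split.
  move=> X T _ [sigma [s0 cs /(AC_sigma_real_parts s0 cs)]].
  by move=> [A [B [D [wA wB _ [AB _] [TE _]]]]]; exists A, B.
exists (bvseq R), (mult (zigzag R)); split.
- exact: mult_continuous.
- exact: zigzag_AC_operator.
- exact: zigzag_not_AC_sigma.
Qed.
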